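(* Let $A$ be a self-adjoint operator in a Krein space $(\mathcal H,[\cdot,\cdot])$. Then $A$ is non-negative if and only if the following three conditions are satisfied: (i) $\sigma(A)\subset\mathbb R$, $\sigma(A)\cap\mathbb R^+\subset\sigma_+(A)$ and $\sigma(A)\cap\mathbb R^-\subset\sigma_-(A)$. (ii) The growth of the resolvent of $A$ at $\infty$ is of order $2$. (iii) The growth of the resolvent of $A$ at $0$ is of order $2$, and for each sequence $(f_n)$ (of non-zero vectors) in $\operatorname{dom}(A^2)$ with $A^2f_n/\|f_n\|\to 0$ as $n\to\infty$ one has $$\liminf_{n\to\infty}\,[Af_n,f_n]\ge 0.$$
   Context: Let $(\mathcal H,[\cdot,\cdot])$ be a Krein space, $J$ a fixed fundamental symmetry, $(\cdot,\cdot)=[J\cdot,\cdot]$ the induced Hilbert space scalar product, and $\|\cdot\|$ the induced norm. A densely defined operator $A$ in $\mathcal H$ is self-adjoint in the Krein space if $A=A^+$, where $A^+$ is the adjoint with respect to $[\cdot,\cdot]$ (equivalently, $JA$ is self-adjoint in $(\mathcal H,(\cdot,\cdot))$). $\sigma(A)$ and $\rho(A)$ denote the spectrum and resolvent set. Notation: $\mathbb R^+=(0,\infty)$, $\mathbb R^-=(-\infty,0)$, $\overline{\mathbb R}=\mathbb R\cup\{\infty\}$, $\overline{\mathbb C}=\mathbb C\cup\{\infty\}$. Non-negative: a self-adjoint operator $A$ in the Krein space is called non-negative if $\rho(A)\neq\emptyset$ and $[Af,f]\ge 0$ for all $f\in\operatorname{dom}A$. Approximate point spectrum: $\lambda\in\sigma_{ap}(A)$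 if there is a sequence $(f_n)$ in $\operatorname{dom}A$ with $\|f_n\|=1$ and $(A-\lambda)f_n\to0$. Spectral points of definite type: $\sigma_+(A)$ (resp. $\sigma_-(A)$) is the set of all $\lambda\in\sigma_{ap}(A)$ such that for every sequence $(f_n)$ in $\operatorname{dom}A$ with $\|f_n\|=1$ and $(A-\lambda)f_n\to0$ one has $\liminf_{n\to\infty}[f_n,f_n]>0$ (resp. $\limsup_{n\to\infty}[f_n,f_n]<0$). Resolvent growth: for $m\ge1$, the growth of the resolvent of $A$ at $\lambda_0\in\mathbb R$ is of order $m$ if there exist an open neighborhood $\mathcal U\subset\mathbb C$ of $\lambda_0$ and $M>0$ such that $\mathcal U\setminus\mathbb R\subset\rho(A)$ and $\|(A-\lambda)^{-1}\|\le M/|\operatorname{Im}\lambda|^m$ for $\lambda\in\mathcal U\setminus\mathbb R$. The growth of the resolvent of $A$ at $\infty$ is of order $m$ if there exist an open neighborhood $\mathcal U$ of $\infty$ in $\overline{\mathbb C}$ and $M>0$ such that $\mathcal U\setminus\overline{\mathbb R}\subset\rho(A)$ and $\|(A-\lambda)^{-1}\|\le M|\lambda|^{2m-2}/|\operatorname{Im}\lambda|^m$ for $\lambda\in\mathcal U\setminus\overline{\mathbb R}$. *)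

(* Defs.v *)
From HB Require Import structures.
From mathcomp Require Import all_boot all_order all_algebra sesquilinear.
From mathcomp Require Import complex.
From mathcomp Require Import all_classical all_reals all_analysis.

Set Implicit Arguments.
Unset Strict Implicit.
Unset Printing Implicit Defensive.
Import Order.TTheory GRing.Theory Num.Theory.
Import numFieldNormedType.Exports.
Local Open Scope classical_set_scope.
Local Open Scope ring_scope.
Local Open Scope complex_scope.

(* The norm of a normed module over R[i] takes its values in R[i]; rnorm is the
   same (non-negative) number, read in R. *)
Definition rnorm (R : realType) (V : normedZmodType R[i]) (x : V) : R :=
  complex.Re `|x|.

(* A Krein space together with a fundamental symmetry J: the norm of H is the
   one induced by the scalar product (f, g) = [J f, g], so that the completeness
   of H says that this scalar product makes H a Hilbert space. *)
Record kreinSpace (R : realType) (H : completeNormedModType R[i]) := KreinSpace {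
  kform : {hermitian_sym H for (@Num.conj R[i])} ;
  kJ : {linear H -> H} ;
  kJK : forall f, kJ (kJ f) = f ;
  kJ_sym : forall f g, kform (kJ f) g = kform f (kJ g) ;
  kJ_norm : forall f, kform (kJ f) f = `|f| ^+ 2
}.

(* A linear operator, not necessarily bounded or everywhere defined; the values
   of op outside dom are irrelevant. *)
Record operator (R : realType) (H : lmodType R[i]) := Operator {
  dom : set H ;
  op :> H -> H ;
  dom0 : dom 0 ;
  domP : forall (a : R[i]) f g, dom f -> dom g -> dom (a *: f + g) ;
  opP : forall (a : R[i]) f g, dom f -> dom g ->
    op (a *: f + g) = a *: op f + op g
}.

Section KreinOperators.
Variables (R : realType) (H : completeNormedModType R[i]).
Variables (K : kreinSpace H) (A : operator H).

Local Notation "[< f , g >]" := (kform K f g).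

Definition graph : set (H * H) := [set p | dom A p.1 /\ A p.1 = p.2].

Definition adjoint_graph : set (H * H) :=
  [set p | forall f, dom A f -> [< A f, p.1 >] = [< f, p.2 >]].

Definition selfadjoint : Prop := dense (dom A) /\ adjoint_graph = graph.

Definition opnorm (T : H -> H) : \bar R :=
  ereal_sup [set (rnorm (T f))%:E | f in [set f : H | rnorm f <= 1]].

(* (A - l)^-1; only meaningful when A - l is injective on dom A. *)
Definition resolvent (l : R[i]) (g : H) : H :=
  xget 0 [set f | dom A f /\ A f - l *: f = g].

Definition resolvent_set : set R[i] :=
  [set l | set_bij (dom A) [set: H] (fun f => A f - l *: f) /\
           (opnorm (resolvent l) < +oo)%E].

Definition spectrum : set R[i] := ~` resolvent_set.

Definition nonnegative : Prop :=
  [/\ selfadjoint, resolvent_set !=set0 &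
      forall f, dom A f -> 0 <= [< A f, f >]].

Definition approx_eigenseq (l : R[i]) (f : nat -> H) : Prop :=
  [/\ forall n, dom A (f n), forall n, rnorm (f n) = 1 &
      A (f n) - l *: f n @[n --> \oo] --> (0 : H)].

Definition sigma_ap : set R[i] := [set l | exists f, approx_eigenseq l f].

(* [f, f] is real because the form is Hermitian. *)
Definition sigma_plus : set R[i] :=
  [set l | sigma_ap l /\ forall f, approx_eigenseq l f ->
    (0 < limn_einf (fun n => (complex.Re [< f n, f n >])%:E))%E].

Definition sigma_minus : set R[i] :=
  [set l | sigma_ap l /\ forall f, approx_eigenseq l f ->
    (limn_esup (fun n => (complex.Re [< f n, f n >])%:E) < 0)%E].

Definition growth_at (m : nat) (l0 : R) : Prop :=
  exists (U : set (R[i])^o) (M : R),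
    [/\ open U, U l0%:C, 0 < M &
     forall l : R[i], U l -> complex.Im l != 0 ->
       resolvent_set l /\
       (opnorm (resolvent l) <= (M / `|complex.Im l| ^+ m)%:E)%E].

(* The Riemann sphere is the one-point compactification of the plane, whose
   point at infinity is None. *)
Definition growth_at_infty (m : nat) : Prop :=
  exists (U : set (one_point_compactification (R[i])^o)) (M : R),
    [/\ open U, U None, 0 < M &
     forall l : R[i], U (Some l) -> complex.Im l != 0 ->
       resolvent_set l /\
       (opnorm (resolvent l) <=
          (M * rnorm l ^+ (2 * m - 2) / `|complex.Im l| ^+ m)%:E)%E].

End KreinOperators.

(* Main.v *)
Require Import Defs.
From HB Require Import structures.
From mathcomp Require Import all_boot all_order all_algebra sesquilinear.
From mathcomp Require Import complex ring lra.
From mathcomp Require Import all_classical all_reals all_analysis.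

Set Implicit Arguments.
Unset Strict Implicit.
Unset Printing Implicit Defensive.
Import Order.TTheory GRing.Theory Num.Theory.
Import numFieldNormedType.Exports.
Local Open Scope classical_set_scope.
Local Open Scope ring_scope.
Local Open Scope complex_scope.

(* If A is non-negative, [A f, f] is a semi-inner product, and its Cauchy-Schwarz
   inequality at one point of the resolvent set yields
     |l| ||f|| <= C (1 + |l|) (||(A - l) f|| + [A f, f]^(1/2)).
   For non-real l one moreover has |Im l| [A f, f] <= 2 |l| ||(A - l) f|| ||f||;
   together they bound the resolvent, and for real l <> 0 the first inequality
   alone gives the definiteness of the spectrum.

   Conversely, on the upper half-plane put u(l) = Im [R(l) A v, v], which equals
   Im l [A R(l) v, R(l) v].  Definite type makes u bounded below by - C Im l near
   every real x <> 0, so that only 0 and infinity obstruct the minimum principle.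
   For v = (A^2 - r^2)(1 - r^2 A^2) f the double zeros of the factor
   ((l^2 - r^2)(1 - r^2 l^2))^2 at +- r and +- 1/r absorb the singularity
   |Im l|^-2 of the resolvent on the half-circles |l| = r and |l| = 1/r, whence
   u >= - C r on the half-annulus between them; letting r tend to 0 gives
   [A A^2 k, A^2 k] >= 0.  The factor A^2 is removed by writing
   h = (A^2 + e^2) m: then [A h, h] is the sum of [A A^2 m, A^2 m],
   2 e^2 [A A m, A m] and [A p, p] with p = e^2 m, and p is almost annihilated
   by A^2, so that condition (iii) controls the last term as e tends to 0. *)

(** * Real-valued norms and the Krein form *)

(** No spectral function of A is constructed: definite type enters only as a local bound near each
    real point, and everything global is read off from one scalar function on the upper half-plane.
    The polynomial p(A) = (A^2 - r^2)(1 - r^2 A^2) has real coefficients, so [R(l) A p(A) f, p(A) f]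
    is p(l)^2 [R(l) A f, f] plus a polynomial in l with real coefficients. The identity for u needs
    the same vector in both slots, and this is also what squares the zeros of p and so matches
    growth of order 2. On |l| = r one has |l^2 - r^2| = 2 r |Im l|, hence the cancellation is exact
    along the whole half-circle, down to the real axis; the second factor of p is the first one
    transported by l -> 1/l. The leftover polynomial costs only O(r) because its constant term is
    real. The point l = i lies in every half-annulus, v tends to A^2 f, and f = (A - i) k turns R(i)
    A^2 f into A^2 k. *)

Section RealNorm.
Variables (R : realType) (V : normedModType R[i]).
Implicit Types (x y : V) (a z : R[i]).

Lemma rnormE (W : normedZmodType R[i]) (x : W) : `|x| = (rnorm x)%:C.
Proof. by rewrite /rnorm RRe_real ?normr_real. Qed.

Lemma rnorm_ge0 (W : normedZmodType R[i]) (x : W) : 0 <= rnorm x.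
Proof. by rewrite -ler0c -rnormE. Qed.

Lemma rnorm0 (W : normedZmodType R[i]) : rnorm (0 : W) = 0.
Proof. by rewrite /rnorm normr0. Qed.

Lemma rnorm_eq0 (W : normedZmodType R[i]) (x : W) : (rnorm x == 0) = (x == 0).
Proof. by rewrite -(normr_eq0 x) rnormE eq_complex /= eqxx andbT. Qed.

Lemma rnormN (W : normedZmodType R[i]) (x : W) : rnorm (- x) = rnorm x.
Proof. by rewrite /rnorm normrN. Qed.

Lemma rnormD (W : normedZmodType R[i]) (x y : W) :
  rnorm (x + y) <= rnorm x + rnorm y.
Proof. by rewrite -lecR rmorphD /= -!rnormE ler_normD. Qed.

Lemma rnormB (W : normedZmodType R[i]) (x y : W) :
  rnorm (x - y) <= rnorm x + rnorm y.
Proof. by rewrite -(rnormN y) rnormD. Qed.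

Lemma rnormZ a x : rnorm (a *: x) = rnorm a * rnorm x.
Proof.
by apply: complexI; rewrite rmorphM /= -!rnormE normrZ.
Qed.

Lemma rnormM a z : rnorm (a * z) = rnorm a * rnorm z.
Proof.
by apply: complexI; rewrite rmorphM /= -!rnormE normrM.
Qed.

Lemma rnormX a n : rnorm (a ^+ n) = rnorm a ^+ n.
Proof.
by apply: complexI; rewrite rmorphXn /= -!rnormE normrX.
Qed.

Lemma rnormV a : rnorm (a^-1) = (rnorm a)^-1.
Proof.
by apply: complexI; rewrite fmorphV /= -!rnormE normfV.
Qed.

Lemma rnormC (r : R) : rnorm r%:C = `|r|.
Proof.
by rewrite /rnorm normc_def /= expr0n addr0 sqrtr_sqr.
Qed.

Lemma rnorm_i : rnorm ('i%C : R[i]) = 1.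
Proof. by rewrite /rnorm normc_def /= expr0n expr1n add0r sqrtr1. Qed.

Lemma rnorm2 : rnorm (2 : R[i]) = 2.
Proof. by rewrite /rnorm ger0_norm. Qed.

Lemma rnorm_sqr a : rnorm a ^+ 2 = complex.Re a ^+ 2 + complex.Im a ^+ 2.
Proof.
by apply: complexI; rewrite rmorphXn /= -rnormE -add_Re2_Im2.
Qed.

Lemma rnorm_Re a : `|complex.Re a| <= rnorm a.
Proof.
by rewrite -ler_sqr ?nnegrE ?rnorm_ge0 // rnorm_sqr -normrX ger0_norm ?sqr_ge0 //
  lerDl sqr_ge0.
Qed.

Lemma rnorm_Im a : `|complex.Im a| <= rnorm a.
Proof.
by rewrite -ler_sqr ?nnegrE ?rnorm_ge0 // rnorm_sqr -normrX ger0_norm ?sqr_ge0 //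
  lerDr sqr_ge0.
Qed.

Lemma ImD a z : complex.Im (a + z) = complex.Im a + complex.Im z.
Proof. by case: a z => ? ? []. Qed.

Lemma rnorm_conj a : rnorm (conjc a) = rnorm a.
Proof. by rewrite /rnorm normcJ. Qed.

Lemma cvg_rnormP (u : nat -> V) (l : V) :
  u @ \oo --> l <-> forall e : R, 0 < e -> \forall n \near \oo, rnorm (u n - l) < e.
Proof.
split=> [/cvgrPdist_lt ul e e0|ul].
  have := ul e%:C; rewrite ltcR => /(_ e0); apply: filterS => n.
  by rewrite distrC rnormE ltcR.
apply/cvgrPdist_lt => e e0.
have eE : e = (complex.Re e)%:C by rewrite RRe_real // gtr0_real.
move: e0; rewrite eE ltcR => e0.
by apply: filterS (ul _ e0) => n; rewrite distrC rnormE ltcR.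
Qed.

End RealNorm.

Section Complete.
Variables (R : realType) (H : completeNormedModType R[i]).

Lemma rnorm_cauchy_cvg (u : nat -> H) :
  (forall e : R, 0 < e -> exists N : nat, forall n m : nat, (N <= n)%N -> (N <= m)%N ->
     rnorm (u n - u m) < e) -> exists l : H, u @ \oo --> l.
Proof.
move=> cu; exists (lim (u @ \oo)); apply: cauchy_cvg.
apply: cauchy_exP => e e0.
have eE : e = (complex.Re e)%:C by rewrite RRe_real // gtr0_real.
move: e0; rewrite eE ltcR => e0; have [N uN] := cu _ e0.
exists (u N); exists N => // n Nn.
by rewrite -ball_normE /= rnormE ltcR uN //=.
Qed.

End Complete.

Section KreinForm.
Variables (R : realType) (H : completeNormedModType R[i]) (K : kreinSpace H).
Local Notation "[< f , g >]" := (kform K f g).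

Lemma kfDl f g h : [< f + g, h >] = [< f, h >] + [< g, h >].
Proof. exact: linearDl. Qed.
Lemma kfBl f g h : [< f - g, h >] = [< f, h >] - [< g, h >].
Proof. exact: linearBl. Qed.
Lemma kfZl a f h : [< a *: f, h >] = a * [< f, h >].
Proof. exact: linearZl_LR. Qed.
Lemma kfDr f g h : [< h, f + g >] = [< h, f >] + [< h, g >].
Proof. exact: linearDr. Qed.
Lemma kfBr f g h : [< h, f - g >] = [< h, f >] - [< h, g >].
Proof. exact: linearBr. Qed.
Lemma kfZr a f h : [< h, a *: f >] = conjc a * [< h, f >].
Proof. by rewrite linearZr_LR. Qed.
Lemma kfC f g : [< g, f >] = conjc [< f, g >].
Proof. by rewrite hermC /= expr0 mul1r. Qed.

Lemma kf_Im f : complex.Im [< f, f >] = 0.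
Proof.
have := kfC f f; case: [< f, f >] => a b /= [] /eqP.
by rewrite -subr_eq0 opprK -mulr2n mulrn_eq0 => /eqP.
Qed.

End KreinForm.

Section Estimates.
Variables (R : realType) (H : completeNormedModType R[i]) (K : kreinSpace H).
Local Notation "[< f , g >]" := (kform K f g).
Local Notation J := (kJ K).
Implicit Types (f g h : H) (l z : R[i]).

(** Restricting to [z = - t * conjc b] leaves a real quadratic in [t]. It serves the Hilbert norm,
    the form [[A f, f]], and, with [a = 0], the orthogonality in [shift_projection]. *)
Lemma quadratic_discriminant (a c : R) (b : R[i]) : 0 <= c ->
    (forall z : R[i], 0 <= a + 2 * complex.Re (z * b) + rnorm z ^+ 2 * c) ->
  rnorm b ^+ 2 <= a * c.
Proof.
move=> c0 q; set B := rnorm b ^+ 2.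
have qt (t : R) : 0 <= a - 2 * t * B + t ^+ 2 * B * c.
  have := q (- (t%:C * conjc b)); rewrite rnormN !rnormM rnorm_conj exprMn rnormC.
  rewrite real_normK ?num_real // -/B.
  have -> : complex.Re (- (t%:C * b^*) * b) = - t * B.
    by rewrite /B rnorm_sqr; case: b {q B} => x y /=; ring.
  by congr (_ <= _); ring.
have a0 : 0 <= a by have := qt 0; rewrite !(mulr0, mul0r, expr0n, subr0, addr0).
have B0 : 0 <= B by rewrite sqr_ge0.
have [c_eq0|cn0] := eqVneq c 0.
  rewrite c_eq0 mulr0 leNgt; apply/negP => Bp.
  (* With [c = 0] the quadratic is affine in [t], and at this [t] it equals -1. *)
  have := qt ((a + 1) / (2 * B)); rewrite c_eq0 mulr0.
  have -> : (a + 1) / (2 * B) = ((a + 1) / 2) * B^-1 by field; rewrite gt_eqF.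
  have BV : B^-1 * B = 1 by rewrite mulVf // gt_eqF.
  rewrite (_ : a - 2 * ((a + 1) / 2 * B^-1) * B + 0
             = a - (a + 1) * (B^-1 * B)); last by field; rewrite gt_eqF.
  by rewrite BV mulr1 opprD addrA subrr sub0r oppr_ge0 leNgt ltr01.
have cp : 0 < c by rewrite lt_def cn0.
have := qt c^-1; rewrite (_ : a - _ + _ = (a * c - B) / c); last by field; rewrite gt_eqF.
by rewrite pmulr_lge0 ?invr_gt0 // subr_ge0.
Qed.

Lemma kJ_rnorm f : [< J f, f >] = (rnorm f ^+ 2)%:C.
Proof. by rewrite kJ_norm rnormE rmorphXn. Qed.

Lemma rnorm_kJ f : rnorm (J f) = rnorm f.
Proof.
apply/eqP; rewrite -(@eqrXn2 _ 2) ?rnorm_ge0 //; apply/eqP.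
by apply: complexI; rewrite -!kJ_rnorm kJK kJ_sym.
Qed.

Lemma rnorm_sqrD f g z : rnorm (f + z *: g) ^+ 2 =
  rnorm f ^+ 2 + 2 * complex.Re (z * [< J g, f >]) + rnorm z ^+ 2 * rnorm g ^+ 2.
Proof.
have E : (rnorm (f + z *: g) ^+ 2)%:C = (rnorm f ^+ 2)%:C + conjc z * [< J f, g >]
    + z * [< J g, f >] + z * conjc z * (rnorm g ^+ 2)%:C.
  by rewrite -!kJ_rnorm (linearD J) (linearZ_LR J) !(kfDl, kfDr, kfZl, kfZr); ring.
have := congr1 (@complex.Re R) E.
rewrite (kJ_sym K f g) (kfC K (J g) f) (rnorm_sqr z).
case: [< J g, f >] => a b; case: z {E} => x y /= ->; ring.
Qed.

(** [[f, g] = [J (J f), g]] is the scalar product of [J f] with [g], and [J] is isometric. *)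
Lemma kform_CauchySchwarz f g : rnorm [< f, g >] <= rnorm f * rnorm g.
Proof.
rewrite -ler_sqr ?nnegrE ?mulr_ge0 ?rnorm_ge0 // exprMn.
rewrite -{1}(kJK K f) -(rnorm_kJ f) mulrC; apply: quadratic_discriminant => [|z].
  by rewrite sqr_ge0.
by rewrite -rnorm_sqrD sqr_ge0.
Qed.

Lemma parallelogram f g : rnorm (f - g) ^+ 2 =
  2 * rnorm f ^+ 2 + 2 * rnorm g ^+ 2 - rnorm (f + g) ^+ 2.
Proof.
have := rnorm_sqrD f g 1; have := rnorm_sqrD f g (- 1).
rewrite !scaleN1r !scale1r mulN1r mul1r rnormN (_ : rnorm 1 = 1).
  by case: [< _, _ >] => a b /= -> ->; ring.
by rewrite /rnorm normr1.
Qed.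

End Estimates.

Section Operator.
Variables (R : realType) (H : completeNormedModType R[i]) (A : operator H).
Implicit Types (f g h : H) (l z : R[i]).

Lemma domD f g : dom A f -> dom A g -> dom A (f + g).
Proof. by move=> df dg; rewrite -(scale1r f); exact: domP. Qed.
Lemma domZ z f : dom A f -> dom A (z *: f).
Proof. by move=> df; rewrite -(addr0 (z *: f)); apply: domP => //; exact: dom0. Qed.
Lemma domB f g : dom A f -> dom A g -> dom A (f - g).
Proof. by move=> df dg; rewrite -scaleN1r addrC; exact: domP. Qed.

Lemma opD f g : dom A f -> dom A g -> A (f + g) = A f + A g.
Proof. by move=> df dg; rewrite -(scale1r f) opP // !scale1r. Qed.
Lemma op0 : A 0 = 0.
Proof.
have := opD (dom0 A) (dom0 A); rewrite addr0 => /esym/eqP.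
by rewrite -subr_eq0 addrK => /eqP.
Qed.
Lemma opZ z f : dom A f -> A (z *: f) = z *: A f.
Proof.
by move=> df; rewrite -(addr0 (z *: f)) opP ?op0 ?addr0 //; exact: dom0.
Qed.
Lemma opB f g : dom A f -> dom A g -> A (f - g) = A f - A g.
Proof. by move=> df dg; rewrite -(scaleN1r g) (opD df (domZ (-1) dg)) (opZ _ dg) !scaleN1r. Qed.

End Operator.

Section SelfAdjoint.
Variables (R : realType) (H : completeNormedModType R[i]) (K : kreinSpace H).
Variables (A : operator H) (selfadjA : selfadjoint K A).
Local Notation "[< f , g >]" := (kform K f g).
Implicit Types (f g h : H) (l z : R[i]).

Lemma op_sym f g : dom A f -> dom A g -> [< A f, g >] = [< f, A g >].
Proof.
move=> df dg; have [_ E] := selfadjA.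
have : graph A (g, A g) by [].
by rewrite -E => /(_ f df).
Qed.

(** The half of self-adjointness that symmetry lacks: it yields membership in the domain. *)
Lemma adjointP g h : (forall f, dom A f -> [< A f, g >] = [< f, h >]) ->
  dom A g /\ A g = h.
Proof.
move=> gh; have [_ E] := selfadjA.
by have : adjoint_graph K A (g, h) by []; rewrite E.
Qed.

(** [A] is its own adjoint, and the relation defining an adjoint passes to limits because the form
    is continuous. *)
Lemma op_closed (u : nat -> H) f g : (forall n, dom A (u n)) ->
  u @ \oo --> f -> A (u n) @[n --> \oo] --> g -> dom A f /\ A f = g.
Proof.
move=> du uf ug; apply: adjointP => h dh.
apply/eqP; rewrite -subr_eq0 -rnorm_eq0 eq_le rnorm_ge0 andbT.
apply/ler_addgt0Pr => e e0; rewrite add0r.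
set c := rnorm (A h) + rnorm h + 1.
have c0 : 0 < c by rewrite ltr_wpDl // addr_ge0 // rnorm_ge0.
have ec : 0 < e / c by rewrite divr_gt0.
have [N _ Nu] : \forall n \near \oo, rnorm (u n - f) < e / c /\
   rnorm (A (u n) - g) < e / c.
  by apply: filterI; [move/cvg_rnormP: uf|move/cvg_rnormP: ug]; exact.
have [/ltW u1 /ltW u2] := Nu _ (leqnn N).
have -> : [< A h, f >] - [< h, g >] = [< h, A (u N) - g >] - [< A h, u N - f >].
  by rewrite !kfBr (op_sym dh (du N)); ring.
apply: (le_trans (rnormB _ _)).
apply: (@le_trans _ _ (rnorm h * (e / c) + rnorm (A h) * (e / c))).
  by apply: lerD; apply: (le_trans (kform_CauchySchwarz _ _ _)); apply: ler_wpM2l;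
    rewrite ?rnorm_ge0.
rewrite -mulrDl (addrC (rnorm h)) mulrCA -[leRHS]mulr1.
apply: ler_wpM2l; first exact: ltW.
by rewrite ltW // ltr_pdivrMr // mul1r /c ltrDl.
Qed.

End SelfAdjoint.

(** * Resolvents *)

Section Resolvent.
Variables (R : realType) (H : completeNormedModType R[i]) (A : operator H).
Implicit Types (f g h : H) (l z : R[i]).

Lemma resolvent_set_injective l f g : resolvent_set A l -> dom A f -> dom A g ->
  A f - l *: f = A g - l *: g -> f = g.
Proof.
by move=> [[_ inj _] _] df dg; apply: inj; rewrite inE.
Qed.

Lemma resolventP l g : resolvent_set A l ->
  dom A (resolvent A l g) /\ A (resolvent A l g) - l *: resolvent A l g = g.
Proof.
move=> [[_ _ /(_ g I) [f df fg]] _].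
by apply: (@xgetI _ 0 [set f | dom A f /\ A f - l *: f = g] f).
Qed.

Lemma resolvent_op l f : resolvent_set A l -> dom A f ->
  resolvent A l (A f - l *: f) = f.
Proof.
move=> rl df; have [dr rE] := resolventP (A f - l *: f) rl.
exact: (resolvent_set_injective rl).
Qed.

Lemma resolvent_linear l a f g : resolvent_set A l ->
  resolvent A l (a *: f + g) = a *: resolvent A l f + resolvent A l g.
Proof.
move=> rl; have [df fE] := resolventP f rl; have [dg gE] := resolventP g rl.
rewrite -{1}fE -{1}gE -[RHS](resolvent_op rl); last exact: domP.
by rewrite opP // scalerBr scalerDr opprD !scalerA (mulrC l) addrACA.
Qed.

Lemma resolventZ l a f : resolvent_set A l ->
  resolvent A l (a *: f) = a *: resolvent A l f.
Proof.
move=> rl; have [df fE] := resolventP f rl.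
rewrite -{1}fE -[RHS](resolvent_op rl); last exact: domZ.
by rewrite opZ // scalerBr !scalerA (mulrC l).
Qed.

Lemma resolventD l f g : resolvent_set A l ->
  resolvent A l (f + g) = resolvent A l f + resolvent A l g.
Proof. by move=> rl; rewrite -{1}(scale1r f) resolvent_linear // scale1r. Qed.

Lemma resolventB l f g : resolvent_set A l ->
  resolvent A l (f - g) = resolvent A l f - resolvent A l g.
Proof. by move=> rl; rewrite -scaleN1r resolventD // resolventZ // scaleN1r. Qed.

Lemma resolvent_bound l c g : resolvent_set A l ->
  (opnorm (resolvent A l) <= c%:E)%E -> rnorm (resolvent A l g) <= c * rnorm g.
Proof.
move=> rl lec.
have [->|g0] := eqVneq g 0.
  have -> : resolvent A l 0 = 0.
    by rewrite -{1}(scale0r (0 : H)) resolventZ // scale0r.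
  by rewrite !rnorm0 mulr0.
have ng0 : 0 < rnorm g by rewrite lt_def rnorm_eq0 g0 rnorm_ge0.
have nE : rnorm ((rnorm g)^-1%:C) = (rnorm g)^-1.
  by rewrite rnormC ger0_norm // invr_ge0 rnorm_ge0.
have : ((rnorm (resolvent A l ((rnorm g)^-1%:C *: g)))%:E <= c%:E)%E.
  apply: le_trans lec; apply: ereal_sup_ubound; eexists; last by [].
  by rewrite /= rnormZ nE mulVf // rnorm_eq0.
by rewrite lee_fin resolventZ // rnormZ nE mulrC ler_pdivrMr.
Qed.

Lemma resolvent_bounded l : resolvent_set A l ->
  exists2 c, 0 < c & forall g, rnorm (resolvent A l g) <= c * rnorm g.
Proof.
move=> rl; have [_] := rl; case E : opnorm => [c| |] // _; last first.
  (* The formal case [opnorm = -oo]: it lies below 0, so the bound holds with constant 0. *)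
  exists 1 => // g; rewrite mul1r.
  have : (opnorm (resolvent A l) <= 0%:E)%E by rewrite E leNye.
  move=> oE; have le0 := resolvent_bound g rl oE; apply: (le_trans le0).
  by rewrite mul0r rnorm_ge0.
exists (Num.max c 1); first by rewrite lt_max ltr01 orbT.
move=> g; apply: (@le_trans _ _ (c * rnorm g)).
  by apply: resolvent_bound => //; rewrite E.
by rewrite ler_wpM2r ?rnorm_ge0 // le_max lexx.
Qed.

End Resolvent.

Section ResolventCriterion.
Variables (R : realType) (H : completeNormedModType R[i]) (K : kreinSpace H).
Variables (A : operator H) (selfadjA : selfadjoint K A).
Local Notation "[< f , g >]" := (kform K f g).
Local Notation J := (kJ K).
Implicit Types (f g h : H) (l z : R[i]).

Lemma shift_lin l a f g : dom A f -> dom A g ->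
  A (a *: f + g) - l *: (a *: f + g) = a *: (A f - l *: f) + (A g - l *: g).
Proof.
by move=> df dg; rewrite opP // scalerBr scalerDr opprD !scalerA (mulrC l) addrACA.
Qed.

Lemma shift_half l f g : dom A f -> dom A g ->
  A (2^-1 *: (f + g)) - l *: (2^-1 *: (f + g)) =
  2^-1 *: ((A f - l *: f) + (A g - l *: g)).
Proof.
move=> df dg; rewrite opZ ?opD //; last exact: domD.
by rewrite scalerA (mulrC l) -scalerA -scalerBr (scalerDr l) opprD addrACA.
Qed.

(* The residual is minimized over the range by the parallelogram law; the
   minimizing sequence converges in dom A because A - l is bounded below. *)
Lemma shift_projection l c v : 0 < c ->
    (forall h, dom A h -> rnorm h <= c * rnorm (A h - l *: h)) ->
  exists2 f, dom A f &
    forall g, dom A g -> [< A g - l *: g, J (v - (A f - l *: f)) >] = 0.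
Proof.
move=> c0 bnd; pose T f := A f - l *: f.
pose D := [set rnorm (v - T f) | f in dom A]; pose d := inf D.
have D0 : D !=set0 by exists (rnorm (v - T 0)); exists 0 => //; exact: dom0.
have lbD : has_lbound D by exists 0 => _ [f _ <-]; exact: rnorm_ge0.
have d0 : 0 <= d by apply: lb_le_inf => // _ [f _ <-]; exact: rnorm_ge0.
have dle f : dom A f -> d <= rnorm (v - T f) by move=> df; apply: ge_inf => //; exists f.
have /choice[u uP] (n : nat) : exists f, dom A f /\ rnorm (v - T f) < d + n.+1%:R^-1.
  have [_ [f df <-] lt] := @inf_adherent _ D n.+1%:R^-1 ltac:(by rewrite invr_gt0)
    (conj D0 lbD).
  by exists f.
(* The midpoint of two residuals is a residual, so the parallelogram law gives at most 4 (d + e)^2 -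
   4 d^2 = 8 d e + 4 e^2, and [e <= 1]. *)
have close (n m : nat) (e : R) : 0 < e -> e <= 1 -> n.+1%:R^-1 <= e -> m.+1%:R^-1 <= e ->
    rnorm (T (u n) - T (u m)) ^+ 2 <= (8 * d + 4) * e.
  move=> e0 e1 ne me; have [dn ln] := uP n; have [dm lm] := uP m.
  have -> : T (u n) - T (u m) = (v - T (u m)) - (v - T (u n)).
    by move: (T (u n)) (T (u m)) => x y; rewrite opprB [RHS]addrC addrA addrNK.
  rewrite (parallelogram K).
  have -> : v - T (u m) + (v - T (u n)) =
      2 *: (v - T (2^-1 *: (u m + u n))).
    have -> : T (2^-1 *: (u m + u n)) = 2^-1 *: (T (u m) + T (u n)) by exact: shift_half.
    move: (T (u n)) (T (u m)) => x y.
    by rewrite scalerBr scalerA divff ?pnatr_eq0 // scale1r scaler_nat mulr2n addrACA opprD.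
  rewrite rnormZ rnorm2.
  have dh : d <= rnorm (v - T (2^-1 *: (u m + u n))).
    by apply: dle; apply: domZ; exact: domD.
  have := dle _ dn; have := dle _ dm.
  have : rnorm (v - T (u n)) <= d + e by apply: (le_trans (ltW ln)); rewrite lerD2l.
  have : rnorm (v - T (u m)) <= d + e by apply: (le_trans (ltW lm)); rewrite lerD2l.
  move: (rnorm (v - T (u n))) (rnorm (v - T (u m))) dh => x y dh xe ye dx dy.
  move: (rnorm _) dh => z dh; nra.
have cauchyT : forall e : R, 0 < e -> exists N : nat, forall n m : nat,
    (N <= n)%N -> (N <= m)%N -> rnorm (T (u n) - T (u m)) < e.
  move=> e e0; pose q := 8 * d + 4.
  have q0 : 0 < q by rewrite /q; lra.
  pose e' := Num.min 1 (e ^+ 2 / (2 * q)).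
  have e'0 : 0 < e' by rewrite lt_min ltr01 divr_gt0 ?exprn_gt0 // mulr_gt0.
  have [N _ Nu] := near_infty_natSinv_lt (PosNum e'0).
  exists N => n m Nn Nm.
  have : rnorm (T (u n) - T (u m)) ^+ 2 <= q * e'.
    by apply: close; rewrite ?ge_min ?lexx //; apply: ltW; [exact: Nu Nn|exact: Nu Nm].
  have qe : q * e' <= e ^+ 2 / 2.
    apply: (@le_trans _ _ (q * (e ^+ 2 / (2 * q)))).
      by rewrite ler_wpM2l ?(ltW q0) // ge_min lexx orbT.
    by rewrite le_eqVlt; apply/orP; left; apply/eqP; field; rewrite gt_eqF.
  move=> /le_trans/(_ qe) le2.
  rewrite -ltr_sqr ?nnegrE ?rnorm_ge0 ?(ltW e0) //; apply: (le_lt_trans le2).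
  by rewrite ltr_pdivrMr // ltr_pMr ?exprn_gt0 // ltr1n.
have TB f g : dom A f -> dom A g -> T (f - g) = T f - T g.
  move=> df dg; have := shift_lin l (-1) dg df; rewrite !scaleN1r => E.
  by rewrite /T (addrC f) E addrC.
have [f uf] : exists f : H, u @ \oo --> f.
  apply: rnorm_cauchy_cvg => e e0.
  have [N Nu] := cauchyT (e / c) ltac:(by rewrite divr_gt0).
  exists N => n m Nn Nm; have [dn _] := uP n; have [dm _] := uP m.
  apply: (le_lt_trans (bnd _ (domB dn dm))).
  by rewrite -/(T _) TB // mulrC -ltr_pdivlMr // Nu.
have [s us] := rnorm_cauchy_cvg cauchyT.
have [df fE] : dom A f /\ A f = s + l *: f.
  apply: (op_closed selfadjA (u := u)) => //; first by move=> n; have [] := uP n.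
  have -> : (fun n => A (u n)) = (fun n => T (u n) + l *: u n).
    by apply/funext => n; rewrite /T subrK.
  by apply: cvgD => //; apply: cvgZr.
have Tf : T f = s by rewrite /T fE addrK.
have vs : rnorm (v - T f) <= d.
  apply/ler_addgt0Pr => e e0; have e20 : 0 < e / 2 by rewrite divr_gt0.
  have [N _ Nu] : \forall n \near \oo, rnorm (T (u n) - s) < e / 2 /\ n.+1%:R^-1 < e / 2.
    by apply: filterI; [move/cvg_rnormP: us; exact|exact: near_infty_natSinv_lt (PosNum e20)].
  have [lt1 lt2] := Nu _ (leqnn N); have [_ lt3] := uP N.
  have -> : v - T f = (v - T (u N)) + (T (u N) - s) by rewrite Tf addrA addrNK.
  apply: (le_trans (rnormD _ _)); apply: (le_trans (lerD (ltW lt3) (ltW lt1))).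
  by rewrite -addrA lerD2l [leRHS]splitr lerD2r ltW.
exists f => // g dg; apply/eqP; rewrite -rnorm_eq0 -[_ == 0](@expf_eq0 _ _ 2) eq_le sqr_ge0 andbT.
(* Minimality makes 2 Re(z b) + |z|^2 c non-negative for all [z]; the discriminant with [a = 0]
   forces b = 0. *)
rewrite -(mul0r (rnorm (T g) ^+ 2)) -(kJ_sym K (A g - l *: g)).
apply: quadratic_discriminant => [|z]; first exact: sqr_ge0.
have := rnorm_sqrD K (v - T f) (T g) z.
have -> : v - T f + z *: T g = v - T (f - z *: g).
  have := shift_lin l (- z) dg df; rewrite !scaleNr -!/(T _) => E.
  rewrite (addrC f) E; move: (T f) (T g) => x y.
  by rewrite opprD opprK (addrC (z *: y)) addrA.
have dfg : d <= rnorm (v - T (f - z *: g)) by apply: dle; apply: domB => //; exact: domZ.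
rewrite -/(T g).
set a := rnorm (v - T f) in vs *; set b := rnorm (v - T _) in dfg *.
have : a ^+ 2 <= b ^+ 2.
  by rewrite ler_sqr ?nnegrE ?rnorm_ge0 // (le_trans vs).
by move=> ab E; move: ab; rewrite E; lra.
Qed.

(** The lower bound makes [A - l] injective with closed range. If a vector w is Hilbert-orthogonal
    to the range, then [J] w lies in the kernel of [A - conjc l], which is zero by the last
    hypothesis. *)
Lemma bounded_below_resolvent l c : 0 < c ->
    (forall h, dom A h -> rnorm h <= c * rnorm (A h - l *: h)) ->
    (forall h, dom A h -> A h = conjc l *: h -> h = 0) ->
  resolvent_set A l /\ (opnorm (resolvent A l) <= c%:E)%E.
Proof.
move=> c0 bnd inj.
have shiftB f g : dom A f -> dom A g -> A f - l *: f = A g - l *: g -> f = g.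
  move=> df dg E; apply/eqP; rewrite -subr_eq0 -rnorm_eq0 eq_le rnorm_ge0 andbT.
  apply: (le_trans (bnd _ (domB df dg))).
  have -> : A (f - g) - l *: (f - g) = 0.
    rewrite -[f - g]addrC -scaleN1r shift_lin // E scaleN1r addrC subrr //.
  by rewrite rnorm0 mulr0.
have surj v : exists2 f, dom A f & A f - l *: f = v.
  have [f df fv] := shift_projection v c0 bnd.
  exists f => //; set h := J _ in fv.
  have [dh hE] : dom A h /\ A h = conjc l *: h.
    apply: (adjointP selfadjA) => g dg; rewrite kfZr conjcK.
    by apply/eqP; rewrite -subr_eq0 -kfZl -kfBl fv.
  by apply/esym/eqP; rewrite -subr_eq0 -(kJK K (v - _)) -/h (inj _ dh hE) raddf0.
have bij : set_bij (dom A) [set: H] (fun f => A f - l *: f).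
  split=> //.
  - by move=> f g; rewrite !inE; exact: shiftB.
  - by move=> v _; have [f df fv] := surj v; exists f.
have rP g : dom A (resolvent A l g) /\ A (resolvent A l g) - l *: resolvent A l g = g.
  have [f df fv] := surj g.
  by apply: (@xgetI _ 0 [set f | dom A f /\ A f - l *: f = g] f).
have le : (opnorm (resolvent A l) <= c%:E)%E.
  apply: ge_ereal_sup => _ [g /= g1 <-]; rewrite lee_fin.
  have [dr rE] := rP g; apply: (le_trans (bnd _ dr)); rewrite rE.
  by rewrite -[leRHS]mulr1 ler_wpM2l // ltW.
by split=> //; split=> //; apply: le_lt_trans le _; rewrite ltry.
Qed.

End ResolventCriterion.

(** * Non-negative operators *)

(** Here [r], [y], [F], [G], [s] stand for |l|, |Im l|, ||f||, ||(A - l) f|| and [A f, f]^(1/2).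
    Either [G] controls [F] directly, or [F <= 2 k s]; squaring the latter and inserting the bound
    on [s ^+ 2] leaves a common factor [F] to cancel. *)
Lemma nonreal_estimate (R : realType) (C r y G F s : R) :
    0 < y -> y <= r -> 1 <= C -> 0 <= G -> 0 <= F -> 0 <= s ->
    r * F <= C * (1 + r) * (G + s) -> y * s ^+ 2 <= 2 * r * G * F ->
  F <= 8 * (C * (1 + r) / r) ^+ 2 * (r / y) * G.
Proof.
move=> y0 yr C1 G0 F0 s0 FE sE.
have r0 : 0 < r by exact: lt_le_trans yr.
set k := C * (1 + r) / r; set t := r / y.
have k1 : 1 <= k.
  by rewrite /k ler_pdivlMr // mul1r; nra.
have t1 : 1 <= t by rewrite /t ler_pdivlMr // mul1r.
have Fk : F <= k * (G + s).
  by rewrite /k mulrAC ler_pdivlMr // mulrC.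
have st : s ^+ 2 <= 2 * t * (G * F).
  rewrite /t (_ : 2 * (r / y) * (G * F) = 2 * r * G * F / y); last by ring.
  by rewrite ler_pdivlMr // mulrC.
have kt : k <= k ^+ 2 * t by nra.
have [FG|/ltW GF] := leP F (2 * k * G).
  have kG : 0 <= k * G by rewrite mulr_ge0 //; lra.
  by have := ler_wpM2r G0 kt; lra.
have Fs : F <= 2 * k * s by nra.
have F2 : F ^+ 2 <= 4 * k ^+ 2 * s ^+ 2.
  rewrite (_ : 4 * _ * _ = (2 * k * s) ^+ 2); last by ring.
  by rewrite ler_sqr ?nnegrE //; nra.
have [->|Fn0] := eqVneq F 0; first exact:
  (mulr_ge0 (mulr_ge0 (mulr_ge0 (ler0n _ 8) (sqr_ge0 k)) (le_trans ler01 t1)) G0).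
have Fp : 0 < F by rewrite lt_def Fn0.
have : F * F <= (8 * k ^+ 2 * t * G) * F.
  have k20 : 0 <= k ^+ 2 by exact: sqr_ge0.
  have := ler_wpM2l k20 st; rewrite -expr2; lra.
by rewrite ler_pM2r.
Qed.

Section Forward.
Variables (R : realType) (H : completeNormedModType R[i]) (K : kreinSpace H).
Variables (A : operator H) (selfadjA : selfadjoint K A).
Local Notation "[< f , g >]" := (kform K f g).
Local Notation J := (kJ K).
Implicit Types (f g h : H) (l z : R[i]).

Lemma shift_sym l f h : dom A f -> dom A h ->
  [< A f - l *: f, h >] = [< f, A h - conjc l *: h >].
Proof.
by move=> df dh; rewrite kfBl kfBr kfZl kfZr conjcK (op_sym selfadjA).
Qed.

(** By duality ||h||^2 = [(A - l) R(l) J h, h] = [R(l) J h, (A - conjc l) h], so [A - conjc l]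
    inherits the lower bound. This matters because non-negativity supplies one resolvent point,
    while [shift_lower_bound] tests with the resolvent at its conjugate. *)
Lemma resolvent_set_conj l : resolvent_set A l -> resolvent_set A (conjc l).
Proof.
move=> rl; have [c c0 cb] := resolvent_bounded rl.
suff [] : resolvent_set A (conjc l) /\ (opnorm (resolvent A (conjc l)) <= c%:E)%E by [].
apply: (bounded_below_resolvent selfadjA) => // h dh; last first.
  rewrite conjcK => hE; apply: (resolvent_set_injective rl) => //; first exact: dom0.
  by rewrite hE op0 scaler0 !subrr.
have [dr rE] := resolventP (J h) rl.
have [->|h0] := eqVneq h 0.
  by rewrite rnorm0 mulr_ge0 ?rnorm_ge0 // ltW.
have hp : 0 < rnorm h by rewrite lt_def rnorm_eq0 h0 rnorm_ge0.
rewrite -(ler_pM2l hp) -expr2.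
have -> : rnorm h ^+ 2 = complex.Re [< J h, h >] by rewrite kJ_rnorm.
rewrite -{1}rE shift_sym //; apply: (le_trans (ler_norm _)).
apply: (le_trans (rnorm_Re _)); apply: (le_trans (kform_CauchySchwarz _ _ _)).
rewrite mulrA ler_wpM2r ?rnorm_ge0 //; apply: (le_trans (cb _)).
by rewrite rnorm_kJ mulrC.
Qed.

Hypothesis posA : forall f, dom A f -> 0 <= [< A f, f >].

Let q f := complex.Re [< A f, f >].

Lemma Aform_ge0 f : dom A f -> 0 <= q f.
Proof. by move=> /posA; rewrite lecE => /andP[]. Qed.

Lemma Aform_real f : dom A f -> [< A f, f >] = (q f)%:C.
Proof. by move=> /posA p; rewrite RRe_real // ger0_real. Qed.

Lemma Aform_CauchySchwarz f h : dom A f -> dom A h ->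
  rnorm [< A f, h >] <= Num.sqrt (q f) * Num.sqrt (q h).
Proof.
move=> df dh; rewrite -ler_sqr ?nnegrE ?rnorm_ge0 ?mulr_ge0 ?sqrtr_ge0 //.
rewrite exprMn !sqr_sqrtr ?Aform_ge0 // mulrC.
apply: quadratic_discriminant => [|z]; first exact: Aform_ge0.
have d : dom A (z *: f + h) by exact: domP.
have := Aform_ge0 d; congr (0 <= _); rewrite /q opP //.
rewrite !(kfDl, kfDr, kfZl, kfZr) (op_sym selfadjA dh df) (kfC K (A f) h).
rewrite (Aform_real df) (rnorm_sqr z).
move: (q f) [< A h, h >] [< A f, h >] => qf [c c'] [a b].
by case: z {d} => x y /=; ring.
Qed.

Section ResolventPoint.
Variables (l0 : R[i]) (rl0 : resolvent_set A l0).

Lemma shift_lower_bound : exists2 C, 1 <= C & forall l f, dom A f ->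
  rnorm l * rnorm f <=
    C * (1 + rnorm l) * (rnorm (A f - l *: f) + Num.sqrt (q f)).
Proof.
have [c c0 cb] := resolvent_bounded rl0.
have rl0' := resolvent_set_conj rl0.
have [c' c'0 cb'] := resolvent_bounded rl0'.
pose L := rnorm l0; have L0 : 0 <= L by exact: rnorm_ge0.
pose C1 := 1 + L * c' + c'.
have Lc' : 0 <= L * c' by rewrite mulr_ge0 // ltW.
have C10 : 0 < C1 by rewrite /C1; lra.
(* From [A h, h] <= ||A h|| ||h|| <= (1 + L c') c' ||k||^2, and [C1 ^+ 2] dominates (1 + L c')
   c'. *)
have qR k : Num.sqrt (q (resolvent A (conjc l0) k)) <= C1 * rnorm k.
  have [dr rE] := resolventP k rl0'; set h := resolvent _ _ _ in dr rE *.
  rewrite -ler_sqr ?nnegrE ?sqrtr_ge0 //; last by rewrite mulr_ge0 ?rnorm_ge0 // ltW.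
  rewrite sqr_sqrtr ?Aform_ge0 // exprMn.
  apply: (le_trans (ler_norm _)); apply: (le_trans (rnorm_Re _)).
  apply: (le_trans (kform_CauchySchwarz _ _ _)).
  have hk : rnorm h <= c' * rnorm k by exact: cb'.
  have Ahk : rnorm (A h) <= (1 + L * c') * rnorm k.
    rewrite -(subrK (conjc l0 *: h) (A h)) rE; apply: (le_trans (rnormD _ _)).
    by rewrite rnormZ rnorm_conj -/L mulrDl mul1r lerD2l -mulrA ler_wpM2l.
  apply: (@le_trans _ _ (((1 + L * c') * rnorm k) * (c' * rnorm k))).
    by apply: ler_pM => //; exact: rnorm_ge0.
  rewrite mulrACA -expr2 ler_wpM2r ?sqr_ge0 // expr2 /C1; nra.
exists (1 + c + (1 + L) * (C1 + c')).
  have P : 0 <= (1 + L) * (C1 + c') by rewrite mulr_ge0 // addr_ge0 // ltW.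
  by rewrite -addrA lerDl addr_ge0 // ltW.
move=> l f df; set g := A f - l *: f.
have [dr rE] := resolventP f rl0; set u := resolvent _ _ _ in dr rE.
set s := Num.sqrt (q f); have s0 : 0 <= s by exact: sqrtr_ge0.
have g0 : 0 <= rnorm g by exact: rnorm_ge0.
have l00 : 0 <= rnorm l by exact: rnorm_ge0.
have lu : rnorm l * rnorm u <= C1 * s + c' * rnorm g.
  have [->|u0] := eqVneq u 0.
    by rewrite rnorm0 mulr0 addr_ge0 // mulr_ge0 // ltW.
  have up : 0 < rnorm u by rewrite lt_def rnorm_eq0 u0 rnorm_ge0.
  have [dh hE] := resolventP (J u) rl0'.
  have hb := cb' (J u); have qh := qR (J u).
  set h := resolvent _ _ _ in dh hE hb qh.
  have uE : (rnorm u ^+ 2)%:C = [< f, h >].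
    by rewrite -(kJ_rnorm K) kJ_sym -hE -shift_sym // rE.
  rewrite -(ler_pM2r up) -mulrA -expr2.
  have -> : rnorm l * rnorm u ^+ 2 = rnorm (l * [< f, h >]).
    by rewrite rnormM -uE rnormC ger0_norm // sqr_ge0.
  have -> : l * [< f, h >] = [< A f, h >] - [< g, h >].
    by rewrite /g kfBl kfZl opprB addrC subrK.
  apply: (le_trans (rnormB _ _)); rewrite mulrDl; apply: lerD.
    apply: (le_trans (Aform_CauchySchwarz df dh)); rewrite -/s mulrC mulrAC.
    by apply: ler_wpM2r => //; rewrite -(rnorm_kJ K u).
  apply: (le_trans (kform_CauchySchwarz _ _ _)); rewrite mulrC mulrAC.
  by apply: ler_wpM2r => //; rewrite -(rnorm_kJ K u).
have fE : f = resolvent A l0 g + (l - l0) *: u.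
  rewrite -resolventZ // -resolventD // -[LHS](resolvent_op rl0 df).
  by rewrite /g scalerBl addrA subrK.
have fb : rnorm f <= c * rnorm g + (rnorm l + L) * rnorm u.
  rewrite {1}fE; apply: (le_trans (rnormD _ _)); apply: lerD; first exact: cb.
  by rewrite rnormZ ler_wpM2r ?rnorm_ge0 // rnormB.
apply: (@le_trans _ _ (rnorm l * (c * rnorm g) + (rnorm l + L) * (C1 * s + c' * rnorm g))).
  apply: (le_trans (ler_wpM2l l00 fb)); rewrite mulrDr lerD2l mulrCA.
  by apply: ler_wpM2l => //; exact: addr_ge0.
have P1 : 0 <= rnorm l * s by rewrite mulr_ge0.
have P2 : 0 <= rnorm l * rnorm g by rewrite mulr_ge0.
have P3 : (rnorm l + L) <= (1 + L) * (1 + rnorm l) by nra.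
have P4 : C1 * s + c' * rnorm g <= (C1 + c') * (rnorm g + s) by nra.
have P5 : (rnorm l + L) * (C1 * s + c' * rnorm g) <=
   ((1 + L) * (1 + rnorm l)) * ((C1 + c') * (rnorm g + s)).
  apply: ler_pM => //; first exact: addr_ge0.
  by rewrite addr_ge0 // mulr_ge0 // ltW.
have P6 : rnorm l * (c * rnorm g) <= (1 + c) * (1 + rnorm l) * (rnorm g + s).
  rewrite -mulrA mulrCA -subr_ge0.
  rewrite (_ : _ - _ = rnorm g + s + rnorm l * rnorm g + rnorm l * s
     + c * rnorm g + c * s + c * (rnorm l * s)); last by ring.
  by rewrite !addr_ge0 // mulr_ge0 // ltW.
by apply: (le_trans (lerD P6 P5)); rewrite le_eqVlt; apply/orP; left; apply/eqP; ring.
Qed.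

(** With g = (A - l) f, the imaginary part of [g, f] = [A f, f] - l [f, f] bounds |Im l| |[f, f]|,
    and its real part then bounds [A f, f]. *)
Lemma Aform_nonreal_bound l f : dom A f ->
  `|complex.Im l| * q f <= 2 * rnorm l * rnorm (A f - l *: f) * rnorm f.
Proof.
move=> df; set g := A f - l *: f.
have gfE : [< g, f >] = (q f)%:C - l * [< f, f >].
  by rewrite /g kfBl kfZl Aform_real.
have gf : rnorm [< g, f >] <= rnorm g * rnorm f by exact: kform_CauchySchwarz.
have ri := rnorm_Im l; have rr := rnorm_Re l.
have gi := rnorm_Im [< g, f >]; have gr := rnorm_Re [< g, f >].
have fi := kf_Im K f; move: fi gfE; case: [< f, f >] => t t' /= -> gfE.
have E1 : complex.Im [< g, f >] = - (complex.Im l * t).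
  by rewrite gfE; case: (l) => a b /=; ring.
have E2 : q f = complex.Re [< g, f >] + complex.Re l * t.
  by rewrite gfE; case: (l) => a b /=; ring.
have T : `|complex.Im l| * `|t| <= rnorm g * rnorm f.
  by rewrite -normrM -normrN -E1 (le_trans gi).
have Q : q f <= rnorm g * rnorm f + rnorm l * `|t|.
  rewrite E2; apply: lerD; first by rewrite (le_trans (ler_norm _)) // (le_trans gr).
  by apply: (le_trans (ler_norm _)); rewrite normrM ler_wpM2r.
apply: (le_trans (ler_wpM2l (normr_ge0 _) Q)); rewrite mulrDr.
have -> : 2 * rnorm l * rnorm g * rnorm f =
   rnorm l * (rnorm g * rnorm f) + rnorm l * (rnorm g * rnorm f) by ring.
apply: lerD; first by rewrite ler_wpM2r // mulr_ge0 // rnorm_ge0.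
by rewrite mulrCA ler_wpM2l // rnorm_ge0.
Qed.

Lemma nonreal_resolvent_bound : exists2 C, 0 < C & forall l, complex.Im l != 0 ->
  [/\ resolvent_set A l,
      rnorm l <= 1 -> (opnorm (resolvent A l) <= (C / `|complex.Im l| ^+ 2)%:E)%E &
      1 <= rnorm l -> (opnorm (resolvent A l) <=
        (C * rnorm l ^+ 2 / `|complex.Im l| ^+ 2)%:E)%E].
Proof.
have [C C1 Cb] := shift_lower_bound.
have C0 : 0 < C by exact: lt_le_trans C1.
(* The estimate gives 8 C^2 (1 + r)^2 / (r y) with r = |l|, y = |Im l|. Here 1 / (r y) <= 1 / y^2,
   and (1 + r)^2 is at most 4 for r <= 1 and at most 4 r^2 for r >= 1. *)
exists (32 * C ^+ 2); first by rewrite mulr_gt0 // exprn_gt0.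
move=> l il.
have bnd l' : complex.Im l' != 0 -> forall h, dom A h -> rnorm h <=
    8 * (C * (1 + rnorm l') / rnorm l') ^+ 2 * (rnorm l' / `|complex.Im l'|) *
      rnorm (A h - l' *: h).
  move=> il' h dh; apply: (nonreal_estimate (s := Num.sqrt (q h))) => //;
    rewrite ?rnorm_ge0 ?sqrtr_ge0 ?normr_gt0 //.
  - exact: rnorm_Im.
  - exact: Cb.
  - by rewrite sqr_sqrtr ?Aform_ge0 // Aform_nonreal_bound.
have y0 : 0 < `|complex.Im l| by rewrite normr_gt0.
have yr : `|complex.Im l| <= rnorm l by exact: rnorm_Im.
have r0 : 0 < rnorm l by exact: lt_le_trans yr.
have [] := bounded_below_resolvent selfadjA _ (bnd _ il).
- have p1 : 0 < 1 + rnorm l by rewrite addr_gt0.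
  apply: mulr_gt0; rewrite ?divr_gt0 //; apply: mulr_gt0; rewrite ?ltr0n //.
  by rewrite exprn_gt0 // divr_gt0 // mulr_gt0.
- move=> h dh hE; apply/eqP; rewrite -rnorm_eq0 eq_le rnorm_ge0 andbT.
  have il' : complex.Im (conjc l) != 0 by case: (l) il => a b /=; rewrite oppr_eq0.
  apply: (le_trans (bnd _ il' _ dh)).
  by rewrite hE subrr rnorm0 mulr0.
move: (rnorm l) (`|complex.Im l|) y0 yr r0 => r y y0 yr r0 rl le.
have yn : y != 0 by rewrite gt_eqF.
have rn : r != 0 by rewrite gt_eqF.
have E : 8 * (C * (1 + r) / r) ^+ 2 * (r / y) = 8 * C ^+ 2 * (1 + r) ^+ 2 / (r * y).
  by field; rewrite rn yn.
have C2 : 0 < C ^+ 2 by rewrite exprn_gt0.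
split=> // r1; apply: (le_trans le); rewrite lee_fin E.
- rewrite ler_pdivrMr ?mulr_gt0 // [leRHS]mulrAC ler_pdivlMr ?exprn_gt0 //.
  have : (1 + r) ^+ 2 <= 4 by nra.
  have : y ^+ 2 <= r * y by nra.
  move: ((1 + r) ^+ 2) (y ^+ 2) (r * y) (C ^+ 2) (sqr_ge0 (1 + r)) (sqr_ge0 y) C2 => a b c d a0 b0 d0 bc a4.
  have : a * b <= 4 * c by nra.
  move=> /(ler_wpM2l (ltW d0)); nra.
- rewrite ler_pdivrMr ?mulr_gt0 // [leRHS]mulrAC ler_pdivlMr ?exprn_gt0 //.
  have : (1 + r) ^+ 2 <= 4 * r ^+ 2 by nra.
  have : y ^+ 2 <= r * y by nra.
  move: ((1 + r) ^+ 2) (y ^+ 2) (r * y) (C ^+ 2) (r ^+ 2) (sqr_ge0 (1 + r)) (sqr_ge0 y) (sqr_ge0 r) C2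
    => a b c d e a0 b0 e0 d0 bc a4.
  have : a * b <= 4 * e * c by apply: ler_pM.
  move=> /(ler_wpM2l (ltW d0)); nra.
Qed.

End ResolventPoint.
End Forward.

(** * Lower limits of real sequences *)

Section LimInf.
Variable R : realType.
Implicit Types (u : nat -> R) (c : R).

Lemma limn_einfE u : limn_einf (fun n => (u n)%:E) =
  ereal_sup (range (einfs (fun n => (u n)%:E))).
Proof.
by rewrite limn_einf_lim; apply/cvg_lim => //; exact: cvg_einfs_sup.
Qed.

Lemma limn_einf_ge u c : (\forall n \near \oo, c <= u n) ->
  (c%:E <= limn_einf (fun n => (u n)%:E))%E.
Proof.
move=> [N _ Nu]; rewrite limn_einfE; apply: ereal_sup_ge.
exists (einfs (fun n => (u n)%:E) N); first by exists N.
by apply: le_ereal_inf_tmp => _ [m /= Nm <-]; rewrite lee_fin; exact: Nu.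
Qed.

Lemma limn_einf_le u c : (forall n, u n <= c) ->
  (limn_einf (fun n => (u n)%:E) <= c%:E)%E.
Proof.
move=> uc; rewrite limn_einfE; apply: ge_ereal_sup => _ [N _ <-].
apply: ereal_inf_le; exists (u N)%:E; last by rewrite lee_fin.
by exists N => /=.
Qed.

Lemma limn_einf_gt0 u : (0 < limn_einf (fun n => (u n)%:E))%E ->
  exists2 c, 0 < c & \forall n \near \oo, c <= u n.
Proof.
rewrite limn_einfE => /ereal_sup_gt[_ [N _ <-] lt0].
have ule m : (N <= m)%N -> (einfs (fun n => (u n)%:E) N <= (u m)%:E)%E.
  by move=> Nm; apply: ereal_inf_lbound; exists m.
have := ule N (leqnn N).
case E : (einfs _ N) lt0 => [r| |] // r0 _.
exists r => //; exists N => // m Nm; have := ule _ Nm.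
by rewrite E lee_fin.
Qed.

End LimInf.

(** * The three conditions for a non-negative operator *)

Section ForwardConditions.
Variables (R : realType) (H : completeNormedModType R[i]) (K : kreinSpace H).
Variables (A : operator H) (selfadjA : selfadjoint K A).
Local Notation "[< f , g >]" := (kform K f g).
Implicit Types (f g h : H) (l z : R[i]).

(** A real point is its own conjugate, so a lower bound for [A - x] supplies both hypotheses of
    [bounded_below_resolvent]; if it fails for every constant n + 1, the failures form an
    approximate eigensequence. *)
Lemma real_spectrum_sigma_ap (x : R) : spectrum A x%:C -> sigma_ap A x%:C.
Proof.
move=> nr; have key (n : nat) : exists f, [/\ dom A f, rnorm f = 1 &
    rnorm (A f - x%:C *: f) < n.+1%:R^-1].
  apply: contrapT => nf; apply: nr.
  have bnd h : dom A h -> rnorm h <= n.+1%:R * rnorm (A h - x%:C *: h).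
    move=> dh; rewrite leNgt; apply/negP => lt.
    have h0 : 0 < rnorm h.
      by apply: le_lt_trans lt; rewrite mulr_ge0 ?rnorm_ge0.
    apply: nf; exists ((rnorm h)^-1%:C *: h).
    have E : rnorm ((rnorm h)^-1%:C) = (rnorm h)^-1.
      by rewrite rnormC ger0_norm // invr_ge0 ltW.
    split; first exact: domZ.
      by rewrite rnormZ E mulVf // gt_eqF.
    rewrite opZ // scalerA mulrC -scalerA -scalerBr rnormZ E.
    by rewrite mulrC ltr_pdivrMr // mulrC ltr_pdivlMr // mulrC.
  have [] := bounded_below_resolvent selfadjA _ bnd => //.
  move=> h dh; rewrite conjc_real => hE; apply/eqP; rewrite -rnorm_eq0 eq_le.
  by rewrite rnorm_ge0 andbT (le_trans (bnd _ dh)) // hE subrr rnorm0 mulr0.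
have [f fP] := choice key; exists f; split.
- by move=> n; have [] := fP n.
- by move=> n; have [] := fP n.
apply/cvg_rnormP => e e0; apply: filterS (near_infty_natSinv_lt (PosNum e0)) => n.
by rewrite subr0; apply: lt_trans; have [] := fP n.
Qed.

Hypothesis posA : forall f, dom A f -> 0 <= [< A f, f >].

Lemma nonneg_definite_type l0 (x : R) : resolvent_set A l0 -> x != 0 ->
  exists2 c : R, 0 < c & forall f, dom A f -> rnorm f = 1 ->
    rnorm (A f - x%:C *: f) <= c -> c <= x * complex.Re [< f, f >].
Proof.
move=> rl0 x0; have [C C1 Cb] := shift_lower_bound selfadjA posA rl0.
have x0' : 0 < `|x| by rewrite normr_gt0.
pose k := `|x| / (C * (1 + `|x|)).
have Cx : 0 < C * (1 + `|x|) by rewrite mulr_gt0 ?addr_gt0 // (lt_le_trans ltr01).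
have k0 : 0 < k by rewrite divr_gt0.
(* Write g = (A - x) f. From k <= ||g|| + s and ||g|| <= k / 2 follows s^2 >= k^2 / 4; since s^2 = x
   [f, f] + Re [g, f], an error ||g|| <= k^2 / 8 leaves x [f, f] >= k^2 / 8. The factor x treats
   both signs at once. *)
exists (Num.min (k / 2) (k ^+ 2 / 8)).
  by rewrite lt_min !divr_gt0 // exprn_gt0.
move=> f df f1; rewrite le_min => /andP[g1 g2].
have := Cb x%:C f df; rewrite rnormC f1 mulr1 mulrC -ler_pdivrMr // -/k.
set s := Num.sqrt _ => ks; set g := A f - _ in g1 g2 ks *.
have s2 : s ^+ 2 = x * complex.Re [< f, f >] + complex.Re [< g, f >].
  rewrite /s sqr_sqrtr ?(Aform_ge0 posA) // -{1}(subrK (x%:C *: f) (A f)) -/g.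
  by rewrite kfDl kfZl; case: [< g, f >] [< f, f >] => a b [c d] /=; ring.
have gf : complex.Re [< g, f >] <= rnorm g.
  apply: (le_trans (ler_norm _)); apply: (le_trans (rnorm_Re _)).
  by apply: (le_trans (kform_CauchySchwarz _ _ _)); rewrite f1 mulr1.
have s1 : k / 2 <= s by lra.
have : (k / 2) ^+ 2 <= s ^+ 2 by rewrite ler_sqr ?nnegrE ?sqrtr_ge0 ?divr_ge0 // ltW.
rewrite ge_min s2 expr_div_n => s3; apply/orP; right; lra.
Qed.

Lemma nonneg_sigma_definite l0 (x : R) : resolvent_set A l0 -> x != 0 ->
  forall f : nat -> H, approx_eigenseq A x%:C f ->
  exists2 c, 0 < c & \forall n \near \oo, c <= x * complex.Re [< f n, f n >].
Proof.
move=> rl0 x0 f [df f1 /cvg_rnormP fc].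
have [c c0 cP] := nonneg_definite_type rl0 x0.
exists c => //; apply: filterS (fc _ c0) => n; rewrite subr0 => /ltW.
exact: cP.
Qed.

Lemma nonneg_sigma_plus l0 (x : R) : resolvent_set A l0 -> 0 < x ->
  spectrum A x%:C -> sigma_plus K A x%:C.
Proof.
move=> rl0 x0 sx; split; first exact: real_spectrum_sigma_ap.
move=> f af; have [c c0 cf] := nonneg_sigma_definite rl0 (lt0r_neq0 x0) af.
apply: (@lt_le_trans _ _ (c / x)%:E); first by rewrite lte_fin divr_gt0.
apply: limn_einf_ge; apply: filterS cf => n.
by rewrite ler_pdivrMr // mulrC.
Qed.

Lemma nonneg_sigma_minus l0 (x : R) : resolvent_set A l0 -> x < 0 ->
  spectrum A x%:C -> sigma_minus K A x%:C.
Proof.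
move=> rl0 x0 sx; split; first exact: real_spectrum_sigma_ap.
move=> f af; have [c c0 cf] := nonneg_sigma_definite rl0 (ltr0_neq0 x0) af.
rewrite -oppe_gt0 -limn_einfN.
apply: (@lt_le_trans _ _ (c / - x)%:E); first by rewrite lte_fin divr_gt0 ?oppr_gt0.
apply: (@limn_einf_ge _ (fun n => - complex.Re [< f n, f n >])).
apply: filterS cf => n.
by rewrite ler_pdivrMr ?oppr_gt0 // mulrNN mulrC.
Qed.

Lemma nonneg_growth_at0 l0 : resolvent_set A l0 -> growth_at A 2 0.
Proof.
move=> rl0; have [C C0 CP] := nonreal_resolvent_bound selfadjA posA rl0.
exists (ball (0 : R[i]^o) 1), C; split => //.
- exact: ball_open.
- exact: ballxx.
move=> l; rewrite -ball_normE /= sub0r normrN rnormE -[1]/(1%:C) ltcR => /ltW l1 il.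
by have [rl /(_ l1)] := CP l il.
Qed.

(** Used twice: the complement of a square is a neighbourhood of infinity, and half-annuli are
    closed subsets of squares. *)
Lemma compact_complex_square (r : R) :
  compact [set l : R[i]^o | `|complex.Re l| <= r /\ `|complex.Im l| <= r].
Proof.
pose f (p : R * R) : R[i]^o := p.1 +i* p.2.
have cf : continuous f.
  move=> p; apply/cvgrPdist_lt => e e0.
  have eE : e = (complex.Re e)%:C by rewrite RRe_real // gtr0_real.
  move: e0; rewrite eE ltcR => e0; have e20 : 0 < complex.Re e / 2 by rewrite divr_gt0.
  have c1 : (fun q : R * R => q.1) @ p --> p.1 by exact: cvg_fst.
  have c2 : (fun q : R * R => q.2) @ p --> p.2 by exact: cvg_snd.
  move/cvgrPdist_lt : c1 => /(_ _ e20) n1; move/cvgrPdist_lt : c2 => /(_ _ e20) n2.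
  apply: filterS2 n1 n2 => q q1 q2; rewrite rnormE ltcR.
  have -> : f p - f q = (p.1 - q.1)%:C + 'i%C * (p.2 - q.2)%:C.
    by rewrite /f; simpc.
  apply: (le_lt_trans (rnormD _ _)); rewrite rnormM !rnormC.
  by rewrite rnorm_i mul1r (splitr (complex.Re e)) ltrD.
have -> : [set l : R[i]^o | `|complex.Re l| <= r /\ `|complex.Im l| <= r] =
    f @` (`[- r, r] `*` `[- r, r]).
  apply/seteqP; split => [[x y] /= [xr yr]|l [[x y] [/= xr yr] <-]] /=.
    by exists (x, y) => //=; split; rewrite in_itv /= -ler_norml.
  by move: xr yr; rewrite !in_itv /= -!ler_norml.
apply: continuous_compact; first by move=> p; apply: continuous_subspaceT.
by apply: compact_setX; exact: segment_compact.
Qed.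

Lemma nonneg_growth_at_infty l0 : resolvent_set A l0 -> growth_at_infty A 2.
Proof.
move=> rl0; have [C C0 CP] := nonreal_resolvent_bound selfadjA posA rl0.
set W := [set l : R[i]^o | `|complex.Re l| <= 1 /\ `|complex.Im l| <= 1].
have cW : compact W by exact: compact_complex_square.
have clW : closed W by apply: compact_closed => //; exact: norm_hausdorff.
exists ((Some @` ~` W) `|` [set None]), C; split => //.
- rewrite openE => -[l|] //=.
    move=> [[l' Wl [ <-]]|//].
    have nl : nbhs (l' : R[i]^o : topologicalType) (~` W).
      by apply: open_nbhs_nbhs; split=> //; exact: closed_openC.
    have := @one_point_compactification_some_nbhs (R[i]^o : topologicalType) l' _ nl.
    by apply: filterS => x Wx; left.
  by move=> _; exists W.
- by right.
move=> l [[l' nW [El]]|//] il; rewrite {}El in nW; have [rl _ b] := CP l il; split=> //; apply: b.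
rewrite leNgt; apply/negP => /ltW l1; apply: nW; split.
- exact: le_trans (rnorm_Re _) l1.
- exact: le_trans (rnorm_Im _) l1.
Qed.

End ForwardConditions.

(** * Points of definite type *)

Section LocalConditions.
Variables (R : realType) (H : completeNormedModType R[i]) (K : kreinSpace H).
Variables (A : operator H) (selfadjA : selfadjoint K A).
Local Notation "[< f , g >]" := (kform K f g).
Implicit Types (f g h : H) (l z : R[i]).

Lemma Re_kf0 f : complex.Re [< f, 0 >] = 0.
Proof. by rewrite linear0r. Qed.

(** Turns the sequential condition into a uniform threshold. Counterexamples are normalized by
    [[A f, f] = -1], which is free because A^2 f / ||f|| is homogeneous of degree 0; under ||f|| = 1
    the negative values could tend to 0 and give no contradiction. *)
Lemma op_sqr_small_nonneg :
    (forall f : nat -> H,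
        (forall n, f n != 0) ->
        (forall n, dom A (f n) /\ dom A (A (f n))) ->
        `|f n|^-1 *: A (A (f n)) @[n --> \oo] --> (0 : H) ->
        (0 <= limn_einf (fun n => (complex.Re [< A (f n), f n >])%:E))%E) ->
  exists2 d, 0 < d & forall f, dom A f -> dom A (A f) ->
    rnorm (A (A f)) <= d * rnorm f -> 0 <= complex.Re [< A f, f >].
Proof.
move=> seqA; apply: contrapT => nd.
have /choice[f fP] (n : nat) : exists f, [/\ dom A f, dom A (A f),
    rnorm (A (A f)) <= n.+1%:R^-1 * rnorm f & complex.Re [< A f, f >] = - 1].
  apply: contrapT => nf; apply: nd; exists n.+1%:R^-1; first by rewrite invr_gt0.
  move=> f df dAf le; rewrite leNgt; apply/negP => lt; apply: nf.
  set t := complex.Re _ in lt; have t0 : 0 < - t by rewrite oppr_gt0.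
  have c0 : 0 < (Num.sqrt (- t))^-1 by rewrite invr_gt0 sqrtr_gt0.
  exists (((Num.sqrt (- t))^-1)%:C *: f).
  rewrite !opZ //; split; [exact: domZ|exact: domZ| |].
    by rewrite !rnormZ mulrCA ler_wpM2l ?rnorm_ge0.
  rewrite kfZl kfZr conjc_real mulrA -rmorphM /= -invfM -expr2 sqr_sqrtr ?(ltW t0) //.
  rewrite (_ : complex.Re _ = (- t)^-1 * t); last first.
    by rewrite /t; case: [< A f, f >] => a b /=; ring.
  by rewrite invrN mulNr mulVf // ltr0_neq0.
have fn0 n : f n != 0.
  have [_ _ _ E] := fP n; apply: contra_eq_neq E => ->.
  by rewrite Re_kf0 eq_sym oppr_eq0 oner_eq0.
have df n : dom A (f n) /\ dom A (A (f n)) by have [] := fP n.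
have cf : `|f n|^-1 *: A (A (f n)) @[n --> \oo] --> (0 : H).
  apply/cvg_rnormP => e e0; apply: filterS (near_infty_natSinv_lt (PosNum e0)) => n.
  rewrite subr0 rnormZ rnormV; apply: le_lt_trans.
  have fp : 0 < rnorm (f n) by rewrite lt_def rnorm_eq0 fn0 rnorm_ge0.
  have [_ _ le _] := fP n.
  by rewrite rnormE rnormC gtr0_norm // mulrC ler_pdivrMr.
have le1 : (limn_einf (fun n => (complex.Re [< A (f n), f n >])%:E) <= (- 1)%:E)%E.
  by apply: limn_einf_le => n; have [_ _ _ ->] := fP n.
by have := le_trans (seqA f fn0 df cf) le1; rewrite lee_fin oppr_ge0 leNgt ltr01.
Qed.

(* Covers points of the spectrum of positive type for x > 0 and of negative
   type for x < 0, as well as points of the resolvent set. *)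
Lemma definite_type_bound (x : R) :
    (spectrum A x%:C -> forall f : nat -> H, approx_eigenseq A x%:C f ->
      exists2 c, 0 < c & \forall n \near \oo, c <= x * complex.Re [< f n, f n >]) ->
  exists2 e, 0 < e & forall f, dom A f -> rnorm (A f - x%:C *: f) <= e * rnorm f ->
    e * rnorm f ^+ 2 <= x * complex.Re [< f, f >].
Proof.
move=> sx; have [rx|nrx] := pselect (resolvent_set A x%:C).
  have [c c0 cb] := resolvent_bounded rx.
  (* At a point of the resolvent set this constant forces ||f|| <= ||f|| / 2, so only [f = 0]
     remains. *)
  exists (2 * c)^-1; first by rewrite invr_gt0 mulr_gt0.
  move=> f df le; suff -> : f = 0.
    by rewrite rnorm0 expr0n mulr0 Re_kf0 mulr0.
  apply/eqP; rewrite -rnorm_eq0 eq_le rnorm_ge0 andbT.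
  have := cb (A f - x%:C *: f); rewrite resolvent_op // => le2.
  have := le_trans le2 (ler_wpM2l (ltW c0) le).
  rewrite mulrA (_ : c / (2 * c) = 2^-1); last by field; rewrite gt_eqF.
  by have := rnorm_ge0 f; lra.
apply: contrapT => nd.
have /choice[f fP] (n : nat) : exists f, [/\ dom A f, rnorm f = 1,
    rnorm (A f - x%:C *: f) <= n.+1%:R^-1 & x * complex.Re [< f, f >] < n.+1%:R^-1].
  apply: contrapT => nf; apply: nd; exists n.+1%:R^-1; first by rewrite invr_gt0.
  move=> f df le; rewrite leNgt; apply/negP => lt; apply: nf.
  have f0 : 0 < rnorm f.
    rewrite lt_def rnorm_ge0 andbT; apply: contraTneq lt => /eqP.
    rewrite rnorm_eq0 => /eqP ->.
    by rewrite rnorm0 expr0n mulr0 Re_kf0 mulr0 ltxx.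
  have E : rnorm ((rnorm f)^-1%:C) = (rnorm f)^-1.
    by rewrite rnormC ger0_norm // invr_ge0 ltW.
  exists ((rnorm f)^-1%:C *: f); split; first exact: domZ.
  - by rewrite rnormZ E mulVf // gt_eqF.
  - rewrite opZ // scalerA mulrC -scalerA -scalerBr rnormZ E mulrC.
    by rewrite ler_pdivrMr.
  - rewrite kfZl kfZr conjc_real mulrA -rmorphM /=.
    rewrite (_ : complex.Re _ = (rnorm f)^-1 * (rnorm f)^-1 * complex.Re [< f, f >]); last first.
      by case: [< f, f >] => a b /=; ring.
    by rewrite mulrCA -invfM -expr2 mulrC ltr_pdivrMr ?exprn_gt0.
have af : approx_eigenseq A x%:C f.
  split; [by move=> n; have [] := fP n|by move=> n; have [] := fP n|].
  apply/cvg_rnormP => e e0; apply: filterS (near_infty_natSinv_lt (PosNum e0)) => n.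
  by rewrite subr0; apply: le_lt_trans; have [] := fP n.
have [c c0 cf] := sx nrx f af.
have [N _ Nu] := filterI cf (near_infty_natSinv_lt (PosNum c0)).
have [le1 lt1] := Nu N (leqnn N); have [_ _ _ lt2] := fP N.
by have := lt_trans (le_lt_trans le1 lt2) lt1; rewrite ltxx.
Qed.

(** Let g = (A - l) f. If g is small against f, definiteness gives [A f, f] >= (e / 2) ||f||^2 -
    ||g|| ||f||, and completing the square leaves a multiple of ||g||^2. Otherwise ||f|| <= (2 / e)
    ||g||, and every term is O(||g||^2). *)
Lemma definite_type_lower_bound (x e : R) : x != 0 -> 0 < e ->
    (forall f, dom A f -> rnorm (A f - x%:C *: f) <= e * rnorm f ->
      e * rnorm f ^+ 2 <= x * complex.Re [< f, f >]) ->
  exists d C, [/\ 0 < d, 0 <= C & forall l, rnorm (l - x%:C) < d ->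
    forall f, dom A f ->
      - (C * rnorm (A f - l *: f) ^+ 2) <= complex.Re [< A f, f >]].
Proof.
move=> x0 e0 xe; have ax : 0 < `|x| by rewrite normr_gt0.
(* The radius |x| / 2 keeps [Re l] on the side of [x], and e / 2 keeps (A - x) f below e ||f|| in
   the first case. The term 8 |x| / e^2 is 2 |x| (2 / e)^2, from |Re l| <= 2 |x| in the second. *)
exists (Num.min (`|x| / 2) (e / 2)), (8 * `|x| / e ^+ 2 + 2 / e); split.
- by rewrite lt_min !divr_gt0.
- by rewrite addr_ge0 ?divr_ge0 ?mulr_ge0 ?sqr_ge0 // ltW.
move=> l; rewrite lt_min => /andP[lx le] f df; set g := A f - l *: f.
have fE : complex.Re [< A f, f >] =
    complex.Re l * complex.Re [< f, f >] + complex.Re [< g, f >].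
  rewrite -{1}(subrK (l *: f) (A f)) -/g kfDl kfZl.
  have := kf_Im K f; case: [< g, f >] [< f, f >] => a b [c c'] /= ->.
  by case: (l) => ? ? /=; ring.
have gf : `|complex.Re [< g, f >]| <= rnorm g * rnorm f.
  by apply: le_trans (rnorm_Re _) _; exact: kform_CauchySchwarz.
have ff : `|complex.Re [< f, f >]| <= rnorm f ^+ 2.
  by apply: le_trans (rnorm_Re _) _; rewrite expr2; exact: kform_CauchySchwarz.
have gx : rnorm (A f - x%:C *: f) <= rnorm g + e / 2 * rnorm f.
  have -> : A f - x%:C *: f = g + (l - x%:C) *: f.
    by rewrite /g scalerBl addrA subrK.
  apply: (le_trans (rnormD _ _)); rewrite lerD2l rnormZ ler_wpM2r ?rnorm_ge0 //.
  exact: ltW.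
have rl : `|complex.Re l - x| <= rnorm (l - x%:C).
  by apply: le_trans (rnorm_Re _); case: (l) => ? ?.
rewrite fE; move: (complex.Re l) rl {fE} => r rl.
have {}rl : `|r - x| <= `|x| / 2 by rewrite (le_trans rl) // ltW.
have [gs|gl] := leP (rnorm g) (e / 2 * rnorm f).
  have : e * rnorm f ^+ 2 <= x * complex.Re [< f, f >].
    by apply: xe => //; apply: (le_trans gx); lra.
  have := rnorm_ge0 f; have := rnorm_ge0 g; move: gf.
  move: (rnorm g) (rnorm f) (complex.Re [< f, f >]) (complex.Re [< g, f >]).
  move=> G F p q; rewrite ler_norml => /andP[q1 _] G0 F0 xp.
  have rp : e / 2 * F ^+ 2 <= r * p.
    have xp0 : 0 <= x * p by apply: le_trans xp; rewrite mulr_ge0 ?sqr_ge0 // ltW.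
    suff : x * p / 2 <= r * p by lra.
    move: rl; rewrite ler_norml => /andP[r1 r2].
    have [xpos|xneg] : 0 < x \/ x < 0 by move: x0; rewrite neq_lt => /orP[]; [right|left].
      have p0 : 0 <= p by rewrite pmulr_rge0 in xp0.
      by rewrite gtr0_norm // in r1 r2 *; nra.
    have p0 : p <= 0 by rewrite nmulr_rge0 in xp0.
    by rewrite ltr0_norm // in r1 r2 *; nra.
  have Q : - (2 / e * G ^+ 2) <= e / 2 * F ^+ 2 - G * F.
    rewrite -subr_ge0 (_ : _ - _ = (e * F - G) ^+ 2 / (2 * e) + 3 / (2 * e) * G ^+ 2); last first.
      by field; rewrite gt_eqF.
    have e2 : 0 <= 2 * e by rewrite mulr_ge0 // ltW.
    by apply: addr_ge0; [exact: divr_ge0 (sqr_ge0 _) e2|exact: mulr_ge0 (divr_ge0 _ e2) (sqr_ge0 _)].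
  have : 0 <= 8 * `|x| / e ^+ 2 * G ^+ 2.
    by apply: mulr_ge0 (sqr_ge0 _); apply: divr_ge0 (sqr_ge0 _); rewrite mulr_ge0.
  lra.
have F2 : rnorm f <= 2 / e * rnorm g.
  by rewrite mulrAC ler_pdivlMr // mulrC; lra.
have := rnorm_ge0 f; have := rnorm_ge0 g; move: gf ff F2 {gx gl}.
move: (rnorm g) (rnorm f) (complex.Re [< f, f >]) (complex.Re [< g, f >]).
move=> G F p q gf ff F2 G0 F0.
have r2 : `|r| <= 2 * `|x|.
  rewrite -(subrK x r); apply: (le_trans (ler_normD _ _)).
  by apply: le_trans (lerD rl (lexx _)) _; lra.
have rp : `|r * p| <= 2 * `|x| * F ^+ 2.
  by rewrite normrM ler_pM.
have e20 : 0 <= 2 / e by rewrite divr_ge0 // ltW.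
have FF : F ^+ 2 <= (2 / e * G) ^+ 2.
  by rewrite ler_sqr ?nnegrE // mulr_ge0.
have GF : G * F <= G * (2 / e * G) by rewrite ler_wpM2l.
have : 2 * `|x| * F ^+ 2 <= 2 * `|x| * (2 / e * G) ^+ 2.
  by rewrite ler_wpM2l // mulr_ge0 // ltW.
rewrite (_ : 2 * `|x| * (2 / e * G) ^+ 2 = 8 * `|x| / e ^+ 2 * G ^+ 2); last first.
  by field; rewrite gt_eqF.
move: rp gf; rewrite !ler_norml => /andP[rp1 _] /andP[gf1 _].
have -> : (8 * `|x| / e ^+ 2 + 2 / e) * G ^+ 2 =
  8 * `|x| / e ^+ 2 * G ^+ 2 + G * (2 / e * G) by ring.
lra.
Qed.

End LocalConditions.

(** * A minimum principle on half-annuli *)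

Section MaximumPrinciple.
Variable R : realType.
Implicit Types (l z : R[i]).

Lemma nbhs_rnorm l (d : R) (P : R[i] -> Prop) : 0 < d ->
  (forall z, rnorm (z - l) < d -> P z) -> \forall z \near (l : R[i]^o), P z.
Proof.
move=> d0 dP; apply/nbhs_ballP; exists d%:C; first by rewrite /= ltcR.
by move=> z; rewrite -ball_normE /= distrC rnormE ltcR; exact: dP.
Qed.

Lemma continuous_at_rnorm (f : R[i]^o -> R) (l : R[i]^o) :
  (forall e, 0 < e -> exists2 d, 0 < d & forall z, rnorm (z - l) < d -> `|f l - f z| < e) ->
  continuous_at l f.
Proof.
move=> fl; apply/(@cvgrPdist_lt R R _ _ (nbhs_filter (l : R[i]^o))) => e e0.
by have [d d0 fd] := fl e e0; exact: (nbhs_rnorm d0).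
Qed.

Lemma lipschitz_continuous (f : R[i]^o -> R) :
  (forall l z, `|f l - f z| <= rnorm (l - z)) -> continuous f.
Proof.
move=> lf l; apply: continuous_at_rnorm => e e0; exists e => // z zl.
by rewrite distrC (le_lt_trans (lf _ _)).
Qed.

Lemma Re_continuous : continuous (@complex.Re R : R[i]^o -> R).
Proof.
apply: lipschitz_continuous => -[a b] [c d]; exact: (rnorm_Re ((a +i* b) - (c +i* d))).
Qed.

Lemma Im_continuous : continuous (@complex.Im R : R[i]^o -> R).
Proof.
apply: lipschitz_continuous => -[a b] [c d]; exact: (rnorm_Im ((a +i* b) - (c +i* d))).
Qed.

Lemma rnorm_continuous : continuous (@rnorm R R[i] : R[i]^o -> R).
Proof.
apply: lipschitz_continuous => l z.
have D (a b : R[i]) : rnorm a <= rnorm b + rnorm (a - b).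
  by have := rnormD (a - b) b; rewrite subrK addrC.
have := D l z; have := D z l; rewrite -(rnormN (z - l)) opprB => zl lz.
by rewrite ler_norml; apply/andP; split; lra.
Qed.

Definition half_annulus (r1 r2 : R) : set R[i]^o :=
  [set l | [/\ 0 <= complex.Im l, r1 <= rnorm l & rnorm l <= r2]].

Lemma compact_half_annulus r1 r2 : compact (half_annulus r1 r2).
Proof.
have -> : half_annulus r1 r2 =
    [set l : R[i]^o | `|complex.Re l| <= r2 /\ `|complex.Im l| <= r2] `&`
    ((@complex.Im R : R[i]^o -> R) @^-1` [set x | 0 <= x] `&`
     (@rnorm R R[i] : R[i]^o -> R) @^-1` `[r1, r2]).
  apply/seteqP; split => [l /= [l0 l1 l2]|l /= [_ [l0]]]; last first.
    by rewrite in_itv /= => /andP[].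
  split; first by split; apply: (le_trans _ l2); [exact: rnorm_Re|exact: rnorm_Im].
  by rewrite in_itv /= l1 l2.
apply: compact_closedI; first exact: compact_complex_square.
apply: closedI; apply: closed_comp.
- by move=> l _; exact: Im_continuous.
- exact: closed_ge.
- by move=> l _; exact: rnorm_continuous.
- exact: itv_closed.
Qed.

(** Stands in for holomorphy and comes directly from iterating the resolvent identity. That [c1] and
    [c2] are complex numbers multiplying powers of [z] is essential: it makes the quadratic terms at
    z and iz cancel. *)
Definition approx_quadratic (phi : R[i] -> R[i]) (l : R[i]) : Prop :=
  exists c1 c2 (C d : R), [/\ 0 < d, 0 <= C & forall z, rnorm z <= d ->
    rnorm (phi (l + z) - phi l - c1 * z - c2 * z ^+ 2) <= C * rnorm z ^+ 3].

Lemma approx_quadratic_continuous phi l : approx_quadratic phi l ->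
  continuous_at (l : R[i]^o) (fun z : R[i]^o => complex.Im (phi z)).
Proof.
move=> [c1 [c2 [C [d [d0 C0 pl]]]]].
set M := rnorm c1 + rnorm c2 + C + 1.
have n1 : 0 <= rnorm c1 by exact: rnorm_ge0.
have n2 : 0 <= rnorm c2 by exact: rnorm_ge0.
have M0 : 0 < M by rewrite /M; lra.
apply: continuous_at_rnorm => e e0.
have d'0 : 0 < Num.min d (Num.min 1 (e / M)) by rewrite !lt_min d0 ltr01 divr_gt0.
eexists; first exact: d'0.
move=> z; rewrite !lt_min => /and3P[zd z1 ze].
have := pl _ (ltW zd); rewrite (addrC l (z - l)) subrK.
move: (z - l) (rnorm_ge0 (z - l)) z1 ze => w w0 w1 we pw.
have -> : complex.Im (phi l) - complex.Im (phi z) = - complex.Im (phi z - phi l).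
  by case: (phi l) (phi z) => a b [a' b'] /=; ring.
rewrite normrN; apply: (le_lt_trans (rnorm_Im _)).
have -> : phi z - phi l = (phi z - phi l - c1 * w - c2 * w ^+ 2) + (c1 * w + c2 * w ^+ 2).
  by ring.
apply: (le_lt_trans (rnormD _ _)).
apply: (@le_lt_trans _ _ (C * rnorm w ^+ 3 + (rnorm c1 * rnorm w + rnorm c2 * rnorm w ^+ 2))).
  by apply: lerD => //; apply: (le_trans (rnormD _ _)); rewrite (rnormM c1) (rnormM c2) rnormX.
move: we; rewrite ltr_pdivlMr //; apply: le_lt_trans; move: (rnorm w) w0 (ltW w1) => t t0 t1.
have t2 : t ^+ 2 <= t by rewrite expr2 -[leRHS]mulr1 ler_wpM2l.
have t3 : t ^+ 3 <= t by rewrite exprS (le_trans _ t2) // expr2 ler_wpM2l.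
rewrite /M !mulrDr mulr1 (mulrC t) (mulrC t) (mulrC t).
have := ler_wpM2l C0 t3; have := ler_wpM2l n2 t2; lra.
Qed.

(* The four-point mean over z, -z, iz, -iz annihilates the linear and the
   quadratic term, which is all that harmonicity is used for. *)
Lemma four_point_mean phi l : approx_quadratic phi l ->
  exists C d : R, [/\ 0 < d, 0 <= C & forall h : R, 0 < h -> h <= d ->
    complex.Im (phi (l + h%:C)) + complex.Im (phi (l - h%:C)) +
    complex.Im (phi (l + 'i%C * h%:C)) + complex.Im (phi (l - 'i%C * h%:C)) <=
    4 * complex.Im (phi l) + C * h ^+ 3].
Proof.
move=> [c1 [c2 [C [d [d0 C0 pl]]]]]; exists (4 * C), d; split => //; first by rewrite mulr_ge0.
move=> h h0 hd.
pose rem z := phi (l + z) - phi l - c1 * z - c2 * z ^+ 2.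
have nh : rnorm h%:C = h by rewrite rnormC gtr0_norm.
have b z : rnorm z = h -> complex.Im (rem z) <= C * h ^+ 3.
  move=> zh; apply: (le_trans (ler_norm _)); apply: (le_trans (rnorm_Im _)).
  by rewrite -zh; apply: pl; rewrite zh.
have b1 := b h%:C nh; have b2 := b (- h%:C) ltac:(by rewrite rnormN).
have b3 := b ('i%C * h%:C) ltac:(by rewrite rnormM rnorm_i mul1r).
have b4 := b (- ('i%C * h%:C)) ltac:(by rewrite rnormN rnormM rnorm_i mul1r).
have S : phi (l + h%:C) + phi (l - h%:C) + phi (l + 'i%C * h%:C) + phi (l - 'i%C * h%:C) =
   4 * phi l + (rem h%:C + rem (- h%:C) + rem ('i%C * h%:C) + rem (- ('i%C * h%:C))).
  by rewrite /rem !sqrrN exprMn sqr_i; ring.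
clearbody rem; have := congr1 (@complex.Im R) S.
have Im4 (x : R[i]) : complex.Im (4 * x) = 4 * complex.Im x.
  rewrite (_ : 4 * x = x + x + x + x); last by ring.
  by rewrite !ImD; ring.
rewrite !ImD Im4; lra.
Qed.

(** Subtracting eta (Re l)^2 makes u strictly superharmonic: its four-point sum changes by -2 eta
    h^2, which beats the remainder C h^3 and excludes an interior minimum. The constants of the
    bound near the axis may vary with [x], since that bound is used only locally. *)
Lemma half_annulus_minimum (phi : R[i] -> R[i]) (r1 r2 m : R) :
    0 < r1 -> r1 < 1 -> 1 < r2 -> 0 <= m ->
    (forall l, 0 < complex.Im l -> approx_quadratic phi l) ->
    (forall l, 0 < complex.Im l -> rnorm l = r1 \/ rnorm l = r2 ->
      - m <= complex.Im (phi l)) ->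
    (forall x : R, x != 0 -> exists d C : R, 0 < d /\ forall l,
      0 < complex.Im l -> rnorm (l - x%:C) < d ->
      - (C * complex.Im l) <= complex.Im (phi l)) ->
  - m <= complex.Im (phi 'i%C).
Proof.
move=> r10 r11 r21 m0 quad arcs axis; rewrite leNgt; apply/negP => lt.
set u := fun l => complex.Im (phi l).
(* The midpoint of [U0] and [- m]. *)
set U0 := u 'i%C; pose c := (U0 - m) / 2.
have U0m : U0 < - m by [].
have U0c : U0 < c by rewrite /c; lra.
have cm : c < - m by rewrite /c; lra.
(* Continuity is checked on full neighbourhoods, so the bound on the perturbation must also cover
   points at distance less than 1 from the half-annulus. *)
pose r3 := r2 + 1.
have r30 : 0 < r3 by rewrite /r3; lra.
pose eta := (- m - c) / (2 * r3 ^+ 2).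
have r32 : 0 < r3 ^+ 2 by rewrite exprn_gt0.
have eta0 : 0 < eta by rewrite divr_gt0 ?subr_gt0 ?mulr_gt0 //; lra.
have etar : eta * r3 ^+ 2 = (- m - c) / 2.
  by rewrite /eta; field; rewrite gt_eqF.
pose v l := u l - eta * complex.Re l ^+ 2.
(* phi need not extend to the real axis; truncating v at c makes it locally
   constant there, hence continuous on the compact half-annulus. *)
pose V (l : R[i]^o) : R := if 0 < complex.Im l then Num.min (v l) c else c.
have Re_r3 l : rnorm l <= r3 -> eta * complex.Re l ^+ 2 <= (- m - c) / 2.
  move=> lr; rewrite -etar ler_wpM2l ?(ltW eta0) //.
  have := rnorm_Re l; rewrite ler_norml => /andP[]; nra.
have r2r3 : r2 <= r3 by rewrite /r3; lra.
have Vc l : V l <= c by rewrite /V; case: ifP => // _; rewrite ge_min lexx orbT.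
have Vv l : 0 < complex.Im l -> V l <= v l by rewrite /V => ->; rewrite ge_min lexx.
have K0 : half_annulus r1 r2 'i%C.
  by split; rewrite /= ?ler01 // rnorm_i ltW.
have Vi : V 'i%C = U0.
  by rewrite /V /v /= ltr01 expr0n mulr0 subr0; apply/min_idPl/ltW.
have cV l : half_annulus r1 r2 l -> continuous_at (l : R[i]^o) V.
  move=> [il l1 l2]; have [i0|] := ltP 0 (complex.Im l).
    have cvl : continuous_at (l : R[i]^o) (fun z : R[i]^o => Num.min (v z) c).
      apply: (@continuous_min R (R[i]^o : topologicalType) v (fun=> c) l); last exact: cst_continuous.
      apply: continuousB; first exact: (approx_quadratic_continuous (quad l i0)).
      apply: continuousM; first exact: cst_continuous.
      by apply: continuousM; exact: Re_continuous.
    move: cvl; rewrite /continuous_at.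
    have -> : V l = Num.min (v l) c by rewrite /V i0.
    apply: cvg_trans; apply: (@near_eq_cvg _ _ _ (nbhs_filter (l : R[i]^o))).
    apply: (nbhs_rnorm i0) => z zl; rewrite /V.
    have -> // : 0 < complex.Im z.
    have := le_lt_trans (rnorm_Im _) zl; case: (z) (l) => a b [a' b'] /=.
    by rewrite ltr_norml => /andP[]; lra.
  move=> i0; have {il i0} il : complex.Im l = 0 by apply/eqP; rewrite eq_le i0.
  have lx : l = (complex.Re l)%:C by rewrite [LHS]complexE il mulr0 addr0.
  have x0 : complex.Re l != 0.
    by apply: contraTneq (lt_le_trans r10 l1) => x0; rewrite lx x0 rnorm0 ltxx.
  have [d [C [d0 dP]]] := axis _ x0.
  (* The perturbation and the term C Im z each cost at most [s], so near a real point v >= -2 s = m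
     + c >= c and the truncation is active. *)
  pose s := (- m - c) / 2.
  have s0 : 0 < s by rewrite /s; lra.
  pose C' := `|C| + 1; have C'0 : 0 < C' by rewrite ltr_wpDl.
  pose d' := Num.min d (Num.min 1 (s / C')).
  have d'0 : 0 < d' by rewrite /d' !lt_min d0 ltr01 divr_gt0.
  apply: continuous_at_rnorm => e e0; exists d' => // z; rewrite /d' !lt_min => /and3P[zd z1 zs].
  suff -> : V z = V l by rewrite subrr normr0.
  rewrite {2}/V il ltxx /V; case: ifP => // iz.
  apply/min_idPr.
  have zr : rnorm z <= r3.
    by rewrite -(subrK l z); apply: (le_trans (rnormD _ _)); rewrite /r3; lra.
  have := Re_r3 _ zr; rewrite -/s => Rz.
  have := dP _ iz; rewrite -lx => /(_ zd) uz.
  have iz' : complex.Im z <= rnorm (z - l).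
    apply: le_trans (rnorm_Im _); apply: le_trans (ler_norm _).
    by move: il; case: (z) (l) => a b [a' b'] /= ->; rewrite subr0.
  move: zs; rewrite ltr_pdivlMr // => zs.
  have Cz : C * complex.Im z <= s.
    apply: (@le_trans _ _ (C' * complex.Im z)).
      by rewrite ler_wpM2r ?(ltW iz) // /C' (le_trans (ler_norm C)) // lerDl.
    apply: le_trans (ltW zs); rewrite mulrC ler_wpM2r // ltW //.
  by rewrite /v /u; rewrite /s in Rz Cz; lra.
have [p] := @compact_EVT_min _ _ V (half_annulus r1 r2) (ex_intro _ _ K0)
  (@compact_half_annulus r1 r2) ltac:(by apply: continuous_in_subspaceT => l; rewrite inE; exact: cV).
rewrite inE => -[ip p1 p2] pmin.
have pc : V p < c by apply: le_lt_trans U0c; rewrite -Vi; apply: pmin; rewrite inE.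
have ip0 : 0 < complex.Im p by move: pc; rewrite /V; case: ifP; rewrite ?ltxx.
have vp : V p = v p.
  move: pc; rewrite /V ip0 => mc; apply/min_idPl; rewrite leNgt; apply/negP => cp.
  by move: mc; rewrite (min_idPr (ltW cp)) ltxx.
have pr : rnorm p != r1 /\ rnorm p != r2.
  have H : ~ (rnorm p = r1 \/ rnorm p = r2).
    move=> /(arcs _ ip0); have := Re_r3 p (le_trans p2 r2r3).
    by move: pc; rewrite vp /v /u; lra.
  by split; apply/eqP => E; apply: H; [left|right].
have {pr} [pr1 pr2] : r1 < rnorm p /\ rnorm p < r2.
  by case: pr => q1 q2; rewrite !lt_neqAle (eq_sym r1) q1 q2 p1 p2.
have [C [d [d0 C0 mean]]] := four_point_mean (quad p ip0).
(* The last bound ensures C h < 2 eta; the others keep the four points in the half-annulus and in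
   the range of the expansion. *)
pose h := Num.min (Num.min d (complex.Im p / 2))
  (Num.min (Num.min (rnorm p - r1) (r2 - rnorm p)) (eta / (C + 1))).
have C10 : 0 < C + 1 by rewrite ltr_wpDl.
have h0 : 0 < h by rewrite /h !lt_min d0 !subr_gt0 pr1 pr2 (divr_gt0 eta0 C10) (divr_gt0 ip0).
have : h <= h by []; rewrite {2}/h !le_min => /andP[/andP[hd hi] /andP[/andP[h1 h2] hC]].
have near_p z : rnorm z = h -> v p <= v (p + z).
  move=> zh; have iz : 0 < complex.Im (p + z).
    have := rnorm_Im z; rewrite zh; case: (p) (z) ip0 hi => a b [a' b'] /=.
    by move=> ? ?; rewrite ler_norml => /andP[]; lra.
  apply: le_trans (Vv _ iz); rewrite -vp; apply: pmin; rewrite inE; split; first exact: ltW.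
    by have := rnormB (p + z) z; rewrite addrK zh; lra.
  by apply: (le_trans (rnormD _ _)); rewrite zh; lra.
have nh : rnorm h%:C = h by rewrite rnormC gtr0_norm.
have n1 := near_p h%:C nh; have n2 := near_p (- h%:C) ltac:(by rewrite rnormN).
have n3 := near_p ('i%C * h%:C) ltac:(by rewrite rnormM rnorm_i mul1r).
have n4 := near_p (- ('i%C * h%:C)) ltac:(by rewrite rnormN rnormM rnorm_i mul1r).
have := mean h h0 hd; move: n1 n2 n3 n4; rewrite /v -!/(u _).
have -> : complex.Re (p + h%:C) = complex.Re p + h by case: (p).
have -> : complex.Re (p - h%:C) = complex.Re p - h by case: (p).
have -> : complex.Re (p + 'i%C * h%:C) = complex.Re p.
  by case: (p) => a b /=; ring.
have -> : complex.Re (p - 'i%C * h%:C) = complex.Re p.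
  by case: (p) => a b /=; ring.
move: (complex.Re p) => x; move: (u _) (u _) (u _) (u _) (u _) => u0 u1 u2 u3 u4.
have hC2 : C * h ^+ 3 < 2 * eta * h ^+ 2.
  have : h * (C + 1) <= eta by rewrite -ler_pdivlMr.
  have h20 : 0 < h ^+ 2 by rewrite exprn_gt0.
  rewrite exprS => hh; have := ler_wpM2l (ltW h20) hh.
  have := mulr_gt0 h20 h0; have := mulr_gt0 h20 eta0; lra.
rewrite !sqrrD; lra.
Qed.

End MaximumPrinciple.

(** * Estimates on the half-circles *)

Section ArcEstimates.
Variable R : realType.
Implicit Types (l w X Y Z : R[i]) (s t k rho S B : R).

Lemma rnorm_sqr_sub w : rnorm (w ^+ 2 - (rnorm w ^+ 2)%:C) = 2 * rnorm w * `|complex.Im w|.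
Proof.
have -> : (rnorm w ^+ 2)%:C = w * conjc w by rewrite rmorphXn /= -rnormE sqr_normc.
have -> : w ^+ 2 - w * conjc w = w * (2 * (complex.Im w)%:C * 'i%C).
  by rewrite -subcJ; ring.
rewrite !rnormM rnorm_i mulr1 rnormC rnorm2.
by ring.
Qed.

(* The polynomial ((w^2 - k)(1 - k w^2))^2; with k = |w|^2 its double zeros at
   w = |w| and w = -|w| compensate the factor (Im w)^-2 of the resolvent. *)
Definition damping k w : R[i] :=
  (k ^+ 2)%:C * (1 + w ^+ 8) - (2 * (1 + k ^+ 2) * k)%:C * (w ^+ 2 + w ^+ 6)
  + ((1 + k ^+ 2) ^+ 2 + 2 * k ^+ 2)%:C * w ^+ 4.

(** As |w|^2 = w conjc w, the first factor is w (w - conjc w), of modulus 2 |w| |Im w|; the second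
    is at most 2 in modulus. Squaring the product gives 16. *)
Lemma damping_le w : rnorm w <= 1 ->
  rnorm (damping (rnorm w ^+ 2) w) <= 16 * rnorm w ^+ 2 * complex.Im w ^+ 2.
Proof.
move=> w1; set k := rnorm w ^+ 2.
have w0 : 0 <= rnorm w by exact: rnorm_ge0.
have -> : damping k w = ((w ^+ 2 - k%:C) * (1 - k%:C * w ^+ 2)) ^+ 2.
  by rewrite /damping !(rmorphD, rmorphM, rmorphXn, rmorph1) /=; ring.
rewrite rnormX rnormM /k rnorm_sqr_sub exprMn.
have n2 : rnorm (1 - (rnorm w ^+ 2)%:C * w ^+ 2) <= 2.
  apply: (le_trans (rnormB _ _)); rewrite rnormM rnormX rnormC.
  rewrite {1}/rnorm normr1 /= (ger0_norm (sqr_ge0 _)) (natrD R 1 1) lerD2l.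
  by rewrite -exprD exprn_ile1.
have n4 : rnorm (1 - (rnorm w ^+ 2)%:C * w ^+ 2) ^+ 2 <= 4.
  by have := rnorm_ge0 (1 - (rnorm w ^+ 2)%:C * w ^+ 2); nra.
rewrite exprMn real_normK ?num_real //.
have P : 0 <= (2 * rnorm w) ^+ 2 * complex.Im w ^+ 2 by rewrite mulr_ge0 ?sqr_ge0.
by have := ler_wpM2l P n4; lra.
Qed.

(** Two steps of the moment recursion. The last summand is real, so the imaginary part keeps a
    factor |l|. *)
Lemma resolvent_moment_zero l S s1 s2 Y Z : rnorm l <= 1 -> `|s1| <= S -> `|s2| <= S ->
    Z = l ^+ 2 * Y + l * s1%:C + s2%:C ->
  `|complex.Im Z| <= rnorm l * (rnorm Y + S) /\ rnorm Z <= rnorm Y + 2 * S.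
Proof.
move=> l1 s1S s2S ZE; have l0 := rnorm_ge0 l; have Y0 := rnorm_ge0 Y.
have l2 : rnorm l ^+ 2 <= rnorm l by rewrite expr2 -[leRHS]mulr1 ler_wpM2l.
have A : rnorm (l ^+ 2 * Y + l * s1%:C) <= rnorm l * (rnorm Y + S).
  apply: (le_trans (rnormD _ _)); rewrite mulrDr; apply: lerD.
    by rewrite rnormM rnormX ler_wpM2r.
  by rewrite rnormM rnormC ler_wpM2l.
split.
  rewrite ZE ImD [complex.Im s2%:C]/= addr0.
  exact: le_trans (rnorm_Im _) A.
rewrite ZE; apply: (le_trans (rnormD _ _)); rewrite rnormC.
have : rnorm l * (rnorm Y + S) <= 1 * (rnorm Y + S).
  by rewrite ler_wpM2r // addr_ge0 // (le_trans (normr_ge0 s1)).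
lra.
Qed.

Lemma weight_le1 k : 0 <= k -> k <= 1 ->
  [/\ k ^+ 2 <= k, 2 * (1 + k ^+ 2) * k <= 4 &
      (1 + k ^+ 2) ^+ 2 + 2 * k ^+ 2 <= 6].
Proof.
move=> k0 k1; have k2 : k ^+ 2 <= k by nra.
have k20 := sqr_ge0 k.
by split => //; nra.
Qed.

Lemma combination_le k t1 t3 t5 t7 t9 : 0 <= k -> k <= 1 ->
  `|k ^+ 2 * (t1 + t9) - 2 * (1 + k ^+ 2) * k * (t3 + t7)
     + ((1 + k ^+ 2) ^+ 2 + 2 * k ^+ 2) * t5|
  <= k ^+ 2 * (`|t1| + `|t9|) + 4 * (`|t3| + `|t7|) + 6 * `|t5|.
Proof.
move=> k0 k1; have [k2 c4 c6] := weight_le1 k0 k1; have k20 := sqr_ge0 k.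
apply: (le_trans (ler_normD _ _)); apply: lerD; last first.
  rewrite normrM ler_wpM2r // ger0_norm //.
  by rewrite addr_ge0 ?sqr_ge0 // mulr_ge0.
apply: (le_trans (ler_normB _ _)); apply: lerD.
  by rewrite normrM (ger0_norm k20) ler_wpM2l // ler_normD.
rewrite normrM; apply: ler_pM => //; last exact: ler_normD.
by rewrite ger0_norm // mulr_ge0 // mulr_ge0 // addr_ge0.
Qed.

Section Moments.
Variables (s : nat -> R) (X : nat -> R[i]) (l : R[i]).
Hypothesis XS : forall n, (n < 9)%N -> X n.+1 = l * X n + (s n)%:C.

(* With X n = [R(l) A^n f, f] this is [R(l) A v, v] for v = (A^2 - k)(1 - k A^2) f. *)
Definition weighted k : R[i] :=
  (k ^+ 2)%:C * (X 1 + X 9) - (2 * (1 + k ^+ 2) * k)%:C * (X 3 + X 7)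
  + ((1 + k ^+ 2) ^+ 2 + 2 * k ^+ 2)%:C * X 5.

Let XSS n : (n < 8)%N -> X n.+2 = l ^+ 2 * X n + l * (s n)%:C + (s n.+1)%:C.
Proof. by move=> n8; rewrite !XS //; [ring|exact: ltnW]. Qed.

Lemma arc_zero S T : (forall n, (n < 9)%N -> `|s n| <= S) -> rnorm l <= 1 ->
    rnorm (X 1) * complex.Im l ^+ 2 <= T ->
  `|complex.Im (weighted (rnorm l ^+ 2))| <= (16 * T + 49 * S) * rnorm l.
Proof.
move=> sS l1 XT; set k := rnorm l ^+ 2.
have l0 := rnorm_ge0 l.
have k0 : 0 <= k by exact: sqr_ge0.
have k1 : k <= 1 by rewrite exprn_ile1.
have S0 : 0 <= S by exact: le_trans (normr_ge0 _) (sS 0%N isT).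
(* The recursion started from 0 in place of [X 1]: then X n = l^(n-1) X 1 + T n, and the weighted
   sum becomes [damping] times [X 1] plus the same combination of the T n. *)
pose T3 := l ^+ 2 * 0 + l * (s 1)%:C + (s 2)%:C.
pose T5 := l ^+ 2 * T3 + l * (s 3)%:C + (s 4)%:C.
pose T7 := l ^+ 2 * T5 + l * (s 5)%:C + (s 6)%:C.
pose T9 := l ^+ 2 * T7 + l * (s 7)%:C + (s 8)%:C.
have [I3 N3] := resolvent_moment_zero l1 (sS 1%N isT) (sS 2%N isT) (erefl T3).
have [I5 N5] := resolvent_moment_zero l1 (sS 3%N isT) (sS 4%N isT) (erefl T5).
have [I7 N7] := resolvent_moment_zero l1 (sS 5%N isT) (sS 6%N isT) (erefl T7).
have [I9 N9] := resolvent_moment_zero l1 (sS 7%N isT) (sS 8%N isT) (erefl T9).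
have E3 : X 3 = l ^+ 2 * X 1 + T3 by rewrite (XSS (n := 1)) // /T3; ring.
have E5 : X 5 = l ^+ 4 * X 1 + T5 by rewrite (XSS (n := 3)) // E3 /T5; ring.
have E7 : X 7 = l ^+ 6 * X 1 + T7 by rewrite (XSS (n := 5)) // E5 /T7; ring.
have E9 : X 9 = l ^+ 8 * X 1 + T9 by rewrite (XSS (n := 7)) // E7 /T9; ring.
have -> : weighted k = damping k l * X 1 +
   ((k ^+ 2)%:C * (0 + T9) - (2 * (1 + k ^+ 2) * k)%:C * (T3 + T7)
   + ((1 + k ^+ 2) ^+ 2 + 2 * k ^+ 2)%:C * T5).
  by rewrite /weighted /damping E3 E5 E7 E9; ring.
rewrite ImD; apply: (le_trans (ler_normD _ _)); rewrite [leRHS]mulrDl; apply: lerD.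
  apply: (le_trans (rnorm_Im _)); rewrite rnormM.
  have X0 := rnorm_ge0 (X 1).
  apply: (le_trans (ler_wpM2r X0 (damping_le l1))).
  have T0 : 0 <= T by apply: le_trans XT; rewrite mulr_ge0 ?sqr_ge0.
  have l2 : rnorm l ^+ 2 <= rnorm l by rewrite expr2 -[leRHS]mulr1 ler_wpM2l.
  have P1 := ler_wpM2l (sqr_ge0 (rnorm l)) XT.
  have P2 := ler_wpM2r T0 l2.
  by lra.
have -> : complex.Im ((k ^+ 2)%:C * (0 + T9) - (2 * (1 + k ^+ 2) * k)%:C * (T3 + T7)
   + ((1 + k ^+ 2) ^+ 2 + 2 * k ^+ 2)%:C * T5) =
  k ^+ 2 * (0 + complex.Im T9) - 2 * (1 + k ^+ 2) * k * (complex.Im T3 + complex.Im T7)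
     + ((1 + k ^+ 2) ^+ 2 + 2 * k ^+ 2) * complex.Im T5.
  move: (k ^+ 2) (2 * (1 + k ^+ 2) * k) ((1 + k ^+ 2) ^+ 2 + 2 * k ^+ 2) => x y z.
  by case: (T3) (T5) (T7) (T9) => ? ? [? ?] [? ?] [? ?] /=; ring.
apply: (le_trans (combination_le _ _ _ _ _ k0 k1)); rewrite normr0 add0r.
rewrite rnorm0 in I3 N3.
have k2 : k ^+ 2 <= 1 by rewrite exprn_ile1.
have J9 : k ^+ 2 * `|complex.Im T9| <= `|complex.Im T9| by rewrite -[leRHS]mul1r ler_wpM2r.
(* The imaginary parts of T3, T5, T7, T9 are at most 1, 3, 5, 7 times S |l|, and 7 + 4 (1 + 5) + 6 *
   3 = 49. *)
have M5 : rnorm l * (rnorm T3 + S) <= rnorm l * (3 * S) by apply: ler_wpM2l => //; lra.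
have M7 : rnorm l * (rnorm T5 + S) <= rnorm l * (5 * S) by apply: ler_wpM2l => //; lra.
have M9 : rnorm l * (rnorm T7 + S) <= rnorm l * (7 * S) by apply: ler_wpM2l => //; lra.
clearbody T3 T5 T7 T9; lra.
Qed.

(** Everything is expressed through [X 7], running the recursion downwards to 5, 3, 1 by division by
    [l] and upwards to 9. The coefficient of [X 7] is then l^2 [damping k w] with w = 1 / l, and Im
    w = - Im l / |l|^2 converts the cancellation at w into one at [l]. *)
Lemma arc_infty S T : (forall n, (n < 9)%N -> `|s n| <= S) -> 1 <= rnorm l ->
    rnorm (X 7) * complex.Im l ^+ 2 <= T * rnorm l ^+ 2 ->
  `|complex.Im (weighted ((rnorm l)^-1 ^+ 2))| <= (16 * T + 36 * S) * (rnorm l)^-1.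
Proof.
move=> sS l1 XT; pose w := l^-1; have lp : 0 < rnorm l by exact: lt_le_trans l1.
have ln0 : l != 0 by rewrite -rnorm_eq0 gt_eqF.
have wE : (rnorm l)^-1 = rnorm w by rewrite rnormV.
have w1 : rnorm w <= 1 by rewrite -wE invf_le1.
have w0 := rnorm_ge0 w.
rewrite wE; set k := rnorm w ^+ 2.
have k0 : 0 <= k by exact: sqr_ge0.
have k1 : k <= 1 by rewrite exprn_ile1.
have S0 : 0 <= S by exact: le_trans (normr_ge0 _) (sS 0%N isT).
have lw : l = w^-1 by rewrite invrK.
have wn0 : w != 0 by rewrite invr_eq0.
pose T5 := w ^+ 2 * 0 - w * (s 5)%:C - w ^+ 2 * (s 6)%:C.
pose T3 := w ^+ 2 * T5 - w * (s 3)%:C - w ^+ 2 * (s 4)%:C.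
pose T1 := w ^+ 2 * T3 - w * (s 1)%:C - w ^+ 2 * (s 2)%:C.
pose T9 := l * (s 7)%:C + (s 8)%:C.
have w2 : rnorm w ^+ 2 <= rnorm w by rewrite expr2 -[leRHS]mulr1 ler_wpM2l.
have step (Y Z : R[i]) a b : `|a| <= S -> `|b| <= S ->
    Z = w ^+ 2 * Y - w * a%:C - w ^+ 2 * b%:C -> rnorm Z <= rnorm Y + 2 * S * rnorm w.
  move=> aS bS ->; apply: (le_trans (rnormB _ _)).
  apply: (@le_trans _ _ (rnorm Y + S * rnorm w + S * rnorm w)); last by lra.
  apply: lerD; last first.
    rewrite rnormM rnormX rnormC mulrC.
    by apply: ler_pM => //; exact: sqr_ge0.
  apply: (le_trans (rnormB _ _)); apply: lerD.
    rewrite rnormM rnormX -[leRHS]mul1r ler_wpM2r ?rnorm_ge0 // exprn_ile1 //.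
  by rewrite rnormM rnormC mulrC ler_wpM2r.
have N5 := step 0 T5 _ _ (sS 5%N isT) (sS 6%N isT) erefl.
have N3 := step T5 T3 _ _ (sS 3%N isT) (sS 4%N isT) erefl.
have N1 := step T3 T1 _ _ (sS 1%N isT) (sS 2%N isT) erefl.
have E9 : X 9 = l ^+ 2 * X 7 + T9 by rewrite (XSS (n := 7)) // /T9; ring.
have E5 : X 5 = w ^+ 2 * X 7 + T5.
  by rewrite (XSS (n := 5)) // /T5 lw; field.
have E3 : X 3 = w ^+ 4 * X 7 + T3.
  have : X 3 = w ^+ 2 * X 5 - w * (s 3)%:C - w ^+ 2 * (s 4)%:C.
    by rewrite (XSS (n := 3)) // lw; field.
  by rewrite E5 /T3 => ->; ring.
have E1 : X 1 = w ^+ 6 * X 7 + T1.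
  have : X 1 = w ^+ 2 * X 3 - w * (s 1)%:C - w ^+ 2 * (s 2)%:C.
    by rewrite (XSS (n := 1)) // lw; field.
  by rewrite E3 /T1 => ->; ring.
have -> : weighted k = l ^+ 2 * damping k w * X 7 +
   ((k ^+ 2)%:C * (T1 + T9) - (2 * (1 + k ^+ 2) * k)%:C * (T3 + 0)
   + ((1 + k ^+ 2) ^+ 2 + 2 * k ^+ 2)%:C * T5).
  by rewrite /weighted /damping E1 E3 E5 E9 lw; field.
rewrite ImD; apply: (le_trans (ler_normD _ _)); rewrite [leRHS]mulrDl; apply: lerD.
  apply: (le_trans (rnorm_Im _)); rewrite (rnormM _ (X 7)) (rnormM (l ^+ 2)) rnormX.
  have X0 := rnorm_ge0 (X 7).
  have := damping_le w1; rewrite -/k => dl.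
  have iw : complex.Im w ^+ 2 = complex.Im l ^+ 2 * (rnorm w ^+ 2) ^+ 2.
    have -> : rnorm w ^+ 2 = (rnorm l ^+ 2)^-1 by rewrite -wE exprVn.
    rewrite rnorm_sqr /w; case: (l) => a b /=.
    by rewrite ?mulNr sqrrN exprMn.
  rewrite iw in dl.
  have l20 : 0 <= rnorm l ^+ 2 by exact: sqr_ge0.
  have := ler_wpM2r X0 (ler_wpM2l l20 dl) => /le_trans; apply.
  have T0 : 0 <= T.
    have : 0 <= T * rnorm l ^+ 2 by apply: le_trans XT; rewrite mulr_ge0 ?sqr_ge0.
    by rewrite pmulr_lge0 // exprn_gt0.
  have rw : rnorm l * rnorm w = 1 by rewrite -wE mulfV // gt_eqF.
  set x := rnorm l in XT rw *; set y := rnorm w in rw w2 w0 *.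
  set z := complex.Im l ^+ 2 in XT *; set v := rnorm (X 7) in XT *.
  have -> : x ^+ 2 * (16 * y ^+ 2 * (z * (y ^+ 2) ^+ 2)) * v =
     16 * (x * y) ^+ 2 * (y ^+ 4 * (v * z)) by ring.
  have y40 : 0 <= y ^+ 4 by rewrite exprn_ge0.
  have := ler_wpM2l y40 XT; rewrite rw expr1n mulr1.
  have -> : y ^+ 4 * (T * x ^+ 2) = T * y ^+ 2 * (x * y) ^+ 2 by ring.
  rewrite rw expr1n mulr1; have := ler_wpM2l T0 w2; lra.
have -> : complex.Im ((k ^+ 2)%:C * (T1 + T9) - (2 * (1 + k ^+ 2) * k)%:C * (T3 + 0)
   + ((1 + k ^+ 2) ^+ 2 + 2 * k ^+ 2)%:C * T5) =
  k ^+ 2 * (complex.Im T1 + complex.Im T9) - 2 * (1 + k ^+ 2) * k * (complex.Im T3 + 0)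
     + ((1 + k ^+ 2) ^+ 2 + 2 * k ^+ 2) * complex.Im T5.
  move: (k ^+ 2) (2 * (1 + k ^+ 2) * k) ((1 + k ^+ 2) ^+ 2 + 2 * k ^+ 2) => x y z.
  by case: (T1) (T3) (T5) (T9) => ? ? [? ?] [? ?] [? ?] /=; ring.
apply: (le_trans (combination_le _ _ _ _ _ k0 k1)); rewrite normr0 addr0.
rewrite rnorm0 in N5.
have k2 : k ^+ 2 <= 1 by rewrite exprn_ile1.
have J1 : k ^+ 2 * `|complex.Im T1| <= `|complex.Im T1| by rewrite -[leRHS]mul1r ler_wpM2r.
(* [T9] grows like |l|, but its weight k^2 = |l|^-4 absorbs this. The total is 6 + 1 + 4 * 4 + 6 * 2
   = 35, below 36. *)
have J9 : k ^+ 2 * `|complex.Im T9| <= S * rnorm w.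
  have -> : complex.Im T9 = complex.Im (l * (s 7)%:C) by rewrite /T9 ImD /= addr0.
  have : `|complex.Im (l * (s 7)%:C)| <= rnorm l * S.
    by apply: (le_trans (rnorm_Im _)); rewrite rnormM rnormC ler_wpM2l ?(ltW lp) // sS.
  have rw : rnorm l * rnorm w = 1 by rewrite -wE mulfV // gt_eqF.
  move=> /(ler_wpM2l (sqr_ge0 k))/le_trans; apply.
  rewrite /k [leLHS](_ : _ = S * (rnorm l * rnorm w) * rnorm w ^+ 3); last by ring.
  rewrite rw mulr1 ler_wpM2l // exprS -[leRHS]mulr1 ler_wpM2l // exprn_ile1 //.
have := rnorm_Im T1; have := rnorm_Im T3; have := rnorm_Im T5.
have Sw : 0 <= S * rnorm w by rewrite mulr_ge0.
clearbody T1 T3 T5 T9; lra.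
Qed.

End Moments.
End ArcEstimates.

(** * From the three conditions to non-negativity *)

Lemma ge0_of_linear_lower_bound (R : realType) (x C e0 : R) : 0 < e0 ->
  (forall e, 0 < e -> e < e0 -> - (C * e) <= x) -> 0 <= x.
Proof.
move=> e00 le; rewrite leNgt; apply/negP => x0.
pose D := `|C| + 1; have D0 : 0 < D by rewrite ltr_wpDl.
pose e := Num.min (e0 / 2) (- x / (2 * D)).
have ep : 0 < e by rewrite lt_min !divr_gt0 ?oppr_gt0 // mulr_gt0.
have el : e < e0.
  by rewrite /e gt_min; apply/orP; left; rewrite ltr_pdivrMr // ltr_pMr // ltr1n.
have eD : D * e <= - x / 2.
  have : e <= - x / (2 * D) by rewrite /e ge_min lexx orbT.
  move=> /(ler_wpM2l (ltW D0))/le_trans; apply.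
  by rewrite le_eqVlt; apply/orP; left; apply/eqP; field; rewrite gt_eqF.
have : C * e <= D * e.
  by rewrite ler_wpM2r ?(ltW ep) // /D (le_trans (ler_norm C)) // lerDl.
by have := le e ep el; lra.
Qed.


(** * Resolvent expansions and domains of powers *)

Section ResolventForms.
Variables (R : realType) (H : completeNormedModType R[i]) (K : kreinSpace H).
Variables (A : operator H) (selfadjA : selfadjoint K A).
Local Notation "[< f , g >]" := (kform K f g).
Local Notation Rl := (resolvent A).
Implicit Types (f g h : H) (l z : R[i]).

Lemma resolvent_identity l z g : resolvent_set A l -> resolvent_set A z ->
  Rl z g = Rl l g + (z - l) *: Rl l (Rl z g).
Proof.
move=> rl rz; have [dz zE] := resolventP g rz.
rewrite -resolventZ // -resolventD // -[LHS](resolvent_op rl) //; congr (Rl l _).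
by move: (Rl z g) zE => u <-; rewrite scalerBl addrA subrK.
Qed.

Lemma resolvent_form_quadratic l f g :
    (forall z, complex.Im z != 0 -> resolvent_set A z) -> 0 < complex.Im l ->
  approx_quadratic (fun z => [< Rl z f, g >]) l.
Proof.
move=> nonreal il; have rl := nonreal _ (lt0r_neq0 il).
have [c c0 cb] := resolvent_bounded rl.
(* The first bound yields ||R(l + z) f|| <= 2 c ||f||, the second keeps l + z in the upper
   half-plane. The remainder is z^3 [R(l)^3 R(l + z) f, g], hence the constant. *)
pose d := Num.min (2 * c)^-1 (complex.Im l / 2).
exists [< Rl l (Rl l f), g >], [< Rl l (Rl l (Rl l f)), g >],
  (c * (c * (c * (2 * c * rnorm f))) * rnorm g), d; split.
- by rewrite lt_min invr_gt0 mulr_gt0 // divr_gt0.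
- by rewrite !mulr_ge0 ?rnorm_ge0 // ltW.
move=> z; rewrite le_min => /andP[zc zi].
have iz : 0 < complex.Im (l + z).
  have := rnorm_Im z; rewrite ler_norml => /andP[i1 i2].
  by move: i1 zi il; case: (l) (z) => a b [a' b'] /=; lra.
have rz := nonreal _ (lt0r_neq0 iz).
have E : Rl (l + z) f = Rl l f + z *: Rl l (Rl (l + z) f).
  by rewrite {1}(resolvent_identity f rl rz) [l + z]addrC addrK.
set u := Rl (l + z) f in E *.
have ub : rnorm u <= 2 * c * rnorm f.
  have : rnorm u <= c * rnorm f + rnorm z * (c * rnorm u).
    rewrite {1}E; apply: (le_trans (rnormD _ _)); apply: lerD; first exact: cb.
    by rewrite rnormZ ler_wpM2l ?rnorm_ge0.
  have : rnorm z * (c * rnorm u) <= (2 * c)^-1 * (c * rnorm u).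
    by rewrite ler_wpM2r // mulr_ge0 ?rnorm_ge0 // ltW.
  have -> : (2 * c)^-1 * (c * rnorm u) = rnorm u / 2 by field; rewrite gt_eqF.
  lra.
have E3 : u = Rl l f + z *: Rl l (Rl l f) + z ^+ 2 *: Rl l (Rl l (Rl l f))
    + z ^+ 3 *: Rl l (Rl l (Rl l u)).
  have E1 : Rl l u = Rl l (Rl l f) + z *: Rl l (Rl l u).
    by rewrite {1}E resolventD // resolventZ.
  have E2 : Rl l (Rl l u) = Rl l (Rl l (Rl l f)) + z *: Rl l (Rl l (Rl l u)).
    by rewrite {1}E1 resolventD // resolventZ.
  by rewrite {1}E {1}E1 {1}E2 !scalerDr !scalerA !addrA !exprS !expr0 !mulr1 ?mulrA.
have -> : [< u, g >] - [< Rl l f, g >] - [< Rl l (Rl l f), g >] * z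
    - [< Rl l (Rl l (Rl l f)), g >] * z ^+ 2 = z ^+ 3 * [< Rl l (Rl l (Rl l u)), g >].
  by rewrite {1}E3 !kfDl !kfZl; ring.
rewrite rnormM rnormX mulrC ler_wpM2r ?exprn_ge0 ?rnorm_ge0 //.
apply: (le_trans (kform_CauchySchwarz _ _ _)); rewrite ler_wpM2r ?rnorm_ge0 //.
do 3! (apply: (le_trans (cb _)); rewrite ler_wpM2l ?(ltW c0) //).
Qed.

Lemma resolvent_op_comm l f : resolvent_set A l -> dom A f ->
  A (Rl l f) = Rl l (A f).
Proof.
move=> rl df; have [dr rE] := resolventP f rl.
rewrite -(subrK (l *: f) (A f)) resolventD // resolvent_op // resolventZ //.
by apply/eqP; rewrite -subr_eq rE.
Qed.

Lemma resolvent_form_op l f g : resolvent_set A l -> dom A f ->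
  [< Rl l (A f), g >] = l * [< Rl l f, g >] + [< f, g >].
Proof.
move=> rl df; rewrite -{1}(subrK (l *: f) (A f)) resolventD // resolvent_op //.
by rewrite resolventZ // kfDl kfZl addrC.
Qed.

Lemma resolvent_form_opr l f g : resolvent_set A l -> dom A g ->
  [< Rl l f, A g >] = l * [< Rl l f, g >] + [< f, g >].
Proof.
move=> rl dg; have [dr rE] := resolventP f rl.
by rewrite -(op_sym selfadjA) // -{1}(subrK (l *: Rl l f) (A _)) rE kfDl kfZl addrC.
Qed.

Lemma op_form_real f : dom A f -> complex.Im [< A f, f >] = 0.
Proof.
move=> df; have := kfC K (A f) f; rewrite -(op_sym selfadjA df df).
case: [< A f, f >] => a b /= [] /eqP.
by rewrite -subr_eq0 opprK -mulr2n mulrn_eq0 => /eqP.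
Qed.

(** Put f = (A - l) R f in the second slot: [A R f, A R f] is real, and what is left is - conjc l
    times the real number [A R f, R f]. *)
Lemma resolvent_form_Im l f : resolvent_set A l -> dom A f ->
  complex.Im [< Rl l (A f), f >] =
  complex.Im l * complex.Re [< A (Rl l f), Rl l f >].
Proof.
move=> rl df; have [dr rE] := resolventP f rl.
rewrite -resolvent_op_comm // -{2}rE kfBr kfZr.
have := op_form_real dr; have := kf_Im K (A (Rl l f)).
case: [< _, Rl l f >] [< _, A (Rl l f) >] => a b [a' b'] /= -> ->.
by case: (l) => ? ? /=; ring.
Qed.

(** The domain of A^n: each application of [A] is checked, since [iter] also computes with
    meaningless values off the domain. *)
Definition iterdom n f := forall j, (j < n)%N -> dom A (iter j A f).

Lemma iterdom_lin n z f g : iterdom n f -> iterdom n g ->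
  iterdom n (z *: f + g) /\
  forall j, (j <= n)%N -> iter j A (z *: f + g) = z *: iter j A f + iter j A g.
Proof.
move=> df dg.
have E j : (j <= n)%N -> iter j A (z *: f + g) = z *: iter j A f + iter j A g.
  elim: j => // j IH jn; rewrite iterS IH 1?ltnW // opP //; [exact: df|exact: dg].
split=> // j jn; rewrite E 1?ltnW //; apply: domP; [exact: df|exact: dg].
Qed.

Lemma iterdom_resolvent n l f : resolvent_set A l -> iterdom n f ->
  iterdom n.+1 (Rl l f) /\ forall j, (j <= n)%N -> iter j A (Rl l f) = Rl l (iter j A f).
Proof.
move=> rl df.
have E j : (j <= n)%N -> iter j A (Rl l f) = Rl l (iter j A f).
  elim: j => // j IH jn; rewrite iterS IH 1?ltnW // resolvent_op_comm //; exact: df.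
by split=> // j jn; rewrite E //; have [] := resolventP (iter j A f) rl.
Qed.

End ResolventForms.

(** * Positivity on ranges of powers of A, and its extension to the domain *)

Section Backward.
Variables (R : realType) (H : completeNormedModType R[i]) (K : kreinSpace H).
Variables (A : operator H) (selfadjA : selfadjoint K A).
Hypothesis nonreal : forall l, complex.Im l != 0 -> resolvent_set A l.
Local Notation "[< f , g >]" := (kform K f g).
Local Notation Rl := (resolvent A).
Implicit Types (f g h : H) (l z : R[i]).

Variables (M0 r0 M1 r1 : R).
Hypotheses (r0_gt0 : 0 < r0) (r1_gt0 : 0 < r1) (M0_ge0 : 0 <= M0) (M1_ge0 : 0 <= M1).
Hypothesis growth0 : forall l, complex.Im l != 0 -> rnorm l < r0 ->
  forall g, rnorm (Rl l g) * complex.Im l ^+ 2 <= M0 * rnorm g.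
Hypothesis growth1 : forall l, complex.Im l != 0 -> r1 < rnorm l ->
  forall g, rnorm (Rl l g) * complex.Im l ^+ 2 <= M1 * rnorm l ^+ 2 * rnorm g.
Hypothesis axis : forall x : R, x != 0 -> exists d C, [/\ 0 < d, 0 <= C &
  forall l, rnorm (l - x%:C) < d -> forall f, dom A f ->
    - (C * rnorm (A f - l *: f) ^+ 2) <= complex.Re [< A f, f >]].

Section Weighted.
Variables (f : H) (f5 : iterdom A 5 f).
Let a j := iter j A f.
Let aS j : A (a j) = a j.+1. Proof. by []. Qed.
(** The moment [R(l) A^n f, f] with the powers shared evenly between the slots, so that n = 9 asks
    only for A^5 f. *)
Let X l n := [< Rl l (a (uphalf n)), a n./2 >].
Let s n := complex.Re [< a (uphalf n), a n./2 >].

Let half_lt5 n : (n < 9)%N -> (n./2 < 5)%N.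
Proof. by do 9?case: n => [|n] //. Qed.

Let moment_real n : (n < 9)%N -> (s n)%:C = [< a (uphalf n), a n./2 >].
Proof.
move=> n9; have dm := f5 (half_lt5 n9).
suff i0 : complex.Im [< a (uphalf n), a n./2 >] = 0.
  by rewrite [RHS]complexE i0 mulr0 addr0.
rewrite uphalf_half; case: (odd n) => /=; last exact: kf_Im.
exact: op_form_real.
Qed.

Let XS l n : resolvent_set A l -> (n < 9)%N -> X l n.+1 = l * X l n + (s n)%:C.
Proof.
move=> rl n9; have dm := f5 (half_lt5 n9); rewrite moment_real // /X.
rewrite [n.+1./2]uphalf_half [uphalf n.+1]/= uphalf_half.
case: (odd n) => /=; first exact: resolvent_form_opr.
exact: resolvent_form_op.
Qed.

(* (A^2 - k)(1 - k A^2) f, expanded. *)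
Definition damped_vector (k : R) : H :=
  (1 + k ^+ 2)%:C *: iter 2 A f - k%:C *: (iter 4 A f + f).

Lemma damped_vector_dom k : dom A (damped_vector k).
Proof.
apply: domB; apply: domZ; first exact: (f5 (j := 2)).
by apply: domD; [exact: (f5 (j := 4))|exact: (f5 (j := 0))].
Qed.

Let op_damped_vector k :
  A (damped_vector k) = (1 + k ^+ 2)%:C *: a 3 - k%:C *: (a 5 + a 1).
Proof.
have d0 : dom A (a 0) := f5 (j := 0) isT.
have d2 : dom A (a 2) := f5 (j := 2) isT.
have d4 : dom A (a 4) := f5 (j := 4) isT.
rewrite /damped_vector opB; [|exact: domZ|by apply: domZ; exact: domD].
by rewrite !opZ ?opD //; exact: domD.
Qed.

(** Expansion gives nine products [R(l) A^i f, A^j f]; by symmetry they depend on i + j alone. *)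
Let damped_form l k : resolvent_set A l ->
  [< Rl l (A (damped_vector k)), damped_vector k >] = weighted (X l) k.
Proof.
move=> rl; rewrite op_damped_vector.
have sh i j : (i < 5)%N -> (j < 5)%N -> [< Rl l (a i.+1), a j >] = [< Rl l (a i), a j.+1 >].
  move=> i5 j5; rewrite -!aS resolvent_form_op ?resolvent_form_opr //; [exact: f5|exact: f5].
have x1 : X l 1 = [< Rl l (a 1), a 0 >] by [].
have x3 : X l 3 = [< Rl l (a 2), a 1 >] by [].
have x5 : X l 5 = [< Rl l (a 3), a 2 >] by [].
have x7 : X l 7 = [< Rl l (a 4), a 3 >] by [].
have x9 : X l 9 = [< Rl l (a 5), a 4 >] by [].
rewrite resolventB // !resolventZ // resolventD // /damped_vector -[f]/(a 0) -/(a 2) -/(a 4).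
rewrite !(kfBl, kfDl, kfZl, kfBr, kfDr, kfZr) !conjc_real /weighted x1 x3 x5 x7 x9.
rewrite (sh 2%N 0%N) // (sh 4%N 2%N) // -(sh 3%N 3%N) // -(sh 1%N 1%N) //.
rewrite (sh 4%N 0%N) // (sh 3%N 1%N) // -(sh 1%N 3%N) // -(sh 2%N 2%N) //.
rewrite !(rmorphD, rmorphM, rmorphXn, rmorph1) /=; ring.
Qed.

Let form_growth l c g h : rnorm (Rl l g) * complex.Im l ^+ 2 <= c * rnorm g ->
  rnorm [< Rl l g, h >] * complex.Im l ^+ 2 <= c * (rnorm g * rnorm h).
Proof.
move=> le; apply: (@le_trans _ _ (rnorm (Rl l g) * rnorm h * complex.Im l ^+ 2)).
  by rewrite ler_wpM2r ?sqr_ge0 // kform_CauchySchwarz.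
by rewrite mulrAC mulrA ler_wpM2r ?rnorm_ge0.
Qed.

(** The constant is uniform in [rho] because the arc estimates involve only the moments of [f]. The
    bound near the axis does depend on [rho] through the norm of the damped vector, which the
    minimum principle tolerates. *)
Lemma damped_lower_bound : exists C rho0, [/\ 0 <= C, 0 < rho0, rho0 <= 1 &
  forall rho, 0 < rho -> rho < rho0 ->
    - (C * rho) <= complex.Re [< A (Rl 'i%C (damped_vector (rho ^+ 2))),
                                 Rl 'i%C (damped_vector (rho ^+ 2)) >]].
Proof.
pose S := \sum_(n < 9) `|s n|.
have sS n : (n < 9)%N -> `|s n| <= S.
  move=> n9; rewrite /S (bigD1 (Ordinal n9)) //= lerDl.
  by apply: sumr_ge0 => i _; exact: normr_ge0.
have S0 : 0 <= S by apply: sumr_ge0 => i _; exact: normr_ge0.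
pose T0 := M0 * (rnorm (a 1) * rnorm (a 0)).
pose T1 := M1 * (rnorm (a 4) * rnorm (a 3)).
have T00 : 0 <= T0 by rewrite !mulr_ge0 ?rnorm_ge0.
have T10 : 0 <= T1 by rewrite !mulr_ge0 ?rnorm_ge0.
have C0 : 0 <= 16 * T0 + 16 * T1 + 49 * S.
  by apply: addr_ge0; [apply: addr_ge0|]; exact: mulr_ge0.
exists (16 * T0 + 16 * T1 + 49 * S), (Num.min 1 (Num.min r0 r1^-1)); split.
- exact: C0.
- by rewrite !lt_min ltr01 r0_gt0 invr_gt0.
- by rewrite ge_min lexx.
move=> rho rho0; rewrite !lt_min => /and3P[rho1 rhor0 rhor1].
set v := damped_vector _; have dv : dom A v by exact: damped_vector_dom.
have iI : complex.Im ('i%C : R[i]) != 0 by rewrite /= oner_eq0.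
suff : - ((16 * T0 + 16 * T1 + 49 * S) * rho) <= complex.Im [< Rl 'i%C (A v), v >].
  by rewrite (resolvent_form_Im selfadjA (nonreal iI) dv) /= mul1r.
apply: (@half_annulus_minimum _ (fun l => [< Rl l (A v), v >]) rho rho^-1) => //.
- by rewrite invf_gt1.
- by rewrite mulr_ge0 ?(ltW rho0).
- by move=> l il; exact: resolvent_form_quadratic.
- move=> l il lr; have il0 := lt0r_neq0 il; have rl := nonreal il0.
  suff : `|complex.Im [< Rl l (A v), v >]| <= (16 * T0 + 16 * T1 + 49 * S) * rho.
    by rewrite ler_norml => /andP[].
  rewrite (damped_form _ rl); case: lr => lr.
    have XT : rnorm (X l 1) * complex.Im l ^+ 2 <= T0.
      by apply: form_growth; apply: growth0 => //; rewrite lr.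
    rewrite -lr; apply: (le_trans (arc_zero (@XS l ^~ rl) sS _ XT)).
      by rewrite lr ltW.
    by rewrite ler_wpM2r ?rnorm_ge0 //; lra.
  have XT : rnorm (X l 7) * complex.Im l ^+ 2 <= T1 * rnorm l ^+ 2.
    apply: le_trans (form_growth (c := M1 * rnorm l ^+ 2) _ _) _.
      by apply: growth1 => //; rewrite lr -[r1]invrK ltf_pV2 // posrE invr_gt0.
    by rewrite /T1 mulrAC.
  have -> : rho = (rnorm l)^-1 by rewrite lr invrK.
  apply: (le_trans (arc_infty (@XS l ^~ rl) sS _ XT)).
    by rewrite lr invf_ge1 // ltW.
  by rewrite ler_wpM2r ?invr_ge0 ?rnorm_ge0 //; lra.
- move=> x x0; have [d [C [d0 _ dC]]] := axis x0.
  exists d, (C * rnorm v ^+ 2); split=> // l il lx.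
  have rl := nonreal (lt0r_neq0 il); have [dr rE] := resolventP v rl.
  rewrite (resolvent_form_Im selfadjA) // mulrC -mulrN ler_wpM2l ?(ltW il) //.
  by have := dC l lx _ dr; rewrite rE.
Qed.

Lemma resolvent_iter2_nonneg :
  0 <= complex.Re [< A (Rl 'i%C (iter 2 A f)), Rl 'i%C (iter 2 A f) >].
Proof.
have [C [rho0 [C0 rho00 rho01 lb]]] := damped_lower_bound.
have iI : complex.Im ('i%C : R[i]) != 0 by rewrite /= oner_eq0.
have ri := nonreal iI.
set b := Rl 'i%C (iter 2 A f); pose b' := Rl 'i%C (iter 4 A f + f).
have [db _] := resolventP (iter 2 A f) ri.
have [db' _] := resolventP (iter 4 A f + f) ri.
pose al := complex.Re [< A b, b >].
pose be := complex.Re [< A b, b' >] + complex.Re [< A b', b >].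
pose ga := complex.Re [< A b', b' >].
have E k : complex.Re [< A (Rl 'i%C (damped_vector k)), Rl 'i%C (damped_vector k) >] =
    (1 + k ^+ 2) ^+ 2 * al - (1 + k ^+ 2) * k * be + k ^+ 2 * ga.
  have -> : Rl 'i%C (damped_vector k) = (1 + k ^+ 2)%:C *: b - k%:C *: b'.
    by rewrite /damped_vector resolventB // !resolventZ.
  rewrite opB ?opZ //; [|exact: domZ|exact: domZ].
  rewrite !(kfBl, kfDl, kfZl, kfBr, kfDr, kfZr) !conjc_real /al /be /ga.
  move: (1 + k ^+ 2) => c.
  by case: [< A b, b >] [< A b, b' >] [< A b', b >] [< A b', b' >]
    => ? ? [? ?] [? ?] [? ?] /=; ring.
(* The form is a polynomial in k = rho^2 with value [al] at 0. Assuming [al <= 0] allows its factor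
   (1 + k^2)^2 to be dropped; the other terms are O(rho). *)
rewrite -/al; case/orP: (le_total 0 al) => [//|al0].
apply: (@ge0_of_linear_lower_bound _ _ (C + 2 * `|be| + `|ga|) rho0 rho00) => rho rhop rhol.
have := lb rho rhop rhol; rewrite E.
have rho1 : rho <= 1 by rewrite (le_trans (ltW rhol)).
have k0 : 0 <= rho ^+ 2 by exact: sqr_ge0.
have kr : rho ^+ 2 <= rho by rewrite expr2 -[leRHS]mulr1 ler_wpM2l // ltW.
move: (rho ^+ 2) k0 kr => k k0 kr.
have k1 : k <= 1 by exact: le_trans rho1.
have kk : k ^+ 2 <= rho by rewrite (le_trans _ kr) // expr2 -[leRHS]mulr1 ler_wpM2l.
have kk0 : 0 <= k ^+ 2 by exact: sqr_ge0.
have kk1 : k ^+ 2 <= 1 by exact: le_trans rho1.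
have t1 : (1 + k ^+ 2) ^+ 2 * al <= al.
  rewrite -[leRHS]mul1r ler_wnM2r // exprn_ege1 //.
  by rewrite lerDl.
have t2 : - ((1 + k ^+ 2) * k * be) <= 2 * rho * `|be|.
  apply: (le_trans (ler_norm _)); rewrite normrN normrM ler_wpM2r //.
  by rewrite ger0_norm ?mulr_ge0 ?addr_ge0 // ler_pM ?addr_ge0 //; lra.
have t3 : k ^+ 2 * ga <= rho * `|ga|.
  by apply: (le_trans (ler_norm _)); rewrite normrM ger0_norm // ler_wpM2r.
by lra.
Qed.

End Weighted.

(** Take f = (A - i) k, for which R(i) A^2 f = A^2 k; this costs one more power of [A]. *)
Lemma iter2_nonneg k : iterdom A 6 k ->
  0 <= complex.Re [< A (iter 2 A k), iter 2 A k >].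
Proof.
move=> k6; have iI : complex.Im ('i%C : R[i]) != 0 by rewrite /= oner_eq0.
have ri := nonreal iI.
have k5 : iterdom A 5 k by move=> j j5; apply: k6; exact: ltnW.
have Ak5 : iterdom A 5 (A k) by move=> j j5; rewrite -iterSr; exact: k6.
have [f5 fE] := iterdom_lin (- 'i%C) k5 Ak5.
set f := - 'i%C *: k + A k in f5 fE.
have -> : iter 2 A k = Rl 'i%C (iter 2 A f).
  rewrite fE // -iterSr iterS scaleNr addrC resolvent_op //; exact: (k6 2%N).
exact: (resolvent_iter2_nonneg f5).
Qed.

Variable d : R.
Hypothesis d_gt0 : 0 < d.
Hypothesis sqr_small : forall f, dom A f -> dom A (A f) ->
  rnorm (A (A f)) <= d * rnorm f -> 0 <= complex.Re [< A f, f >].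

Let ie (e : R) : R[i] := 0 +i* e.
(** This is (A^2 + e^2)^-1 h. *)
Let regular (e : R) h := Rl (ie e) (Rl (ie (- e)) h).

Let ieN e : ie (- e) = - ie e.
Proof. by apply/eqP; rewrite eq_complex /= oppr0 !eqxx. Qed.

Let ie_sqr e : ie e * ie e = - (e ^+ 2)%:C.
Proof. by apply/eqP; rewrite eq_complex /=; apply/andP; split; apply/eqP; ring. Qed.

Let rnorm_ie e : rnorm (ie e) = `|e|.
Proof. by rewrite /rnorm normc_def /= expr0n add0r sqrtr_sqr. Qed.

Let ri (e : R) : e != 0 -> resolvent_set A (ie e).
Proof. by move=> e0; apply: nonreal. Qed.

(** Growth of order 2 at 0 gives ||p|| = O(1/e) only, but ||A p|| = O(1) and A^2 p = e^2 (h - p) =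
    O(e). Either A^2 p is small relative to p and [A p, p] >= 0, or ||p|| <= ||A^2 p|| / d = O(e)
    and then [A p, p] >= - ||A p|| ||p|| = - O(e). *)
Lemma nonneg_of_regularized h : dom A h ->
    (forall e, 0 < e -> 0 <= complex.Re [< A (A (A (regular e h))), A (A (regular e h)) >] /\
       0 <= complex.Re [< A (A (regular e h)), A (regular e h) >]) ->
  0 <= complex.Re [< A h, h >].
Proof.
move=> dh pos.
apply: (@ge0_of_linear_lower_bound _ _ (M0 * rnorm h * ((1 + M0) * rnorm h / d)) (Num.min 1 r0)).
  by rewrite lt_min ltr01.
move=> e e0; rewrite lt_min => /andP[e1 er].
have en0 : e != 0 by rewrite gt_eqF.
have rp : resolvent_set A (ie e) by exact: ri.
have rn : resolvent_set A (ie (- e)) by apply: ri; rewrite oppr_eq0.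
have [pos2 pos1] := pos e e0; rewrite /regular in pos1 pos2.
have bound s g : `|s| = e -> rnorm (Rl (ie s) g) * e ^+ 2 <= M0 * rnorm g.
  move=> se; have := @growth0 (ie s) _ _ g; rewrite rnorm_ie se /= -(real_normK (num_real s)) se.
  by apply=> //; rewrite -normr_gt0 se.
have [du uE] := resolventP h rn.
have bu := bound (- e) h; have bv := bound e h.
set u := Rl (ie (- e)) h in du uE pos1 pos2 bu.
have [dm mE] := resolventP u rp.
(* The resolvent identity between ie and -ie gives 2 i e m = v - u and 2 A m = u + v; so both m and
   A m are controlled by two single resolvents instead of a product. *)
have mdiff : u = Rl (ie e) h - (2 * ie e) *: Rl (ie e) u.
  rewrite {1}/u (resolvent_identity h rp rn) -/u ieN -scaleNr; congr (_ + _ *: _); ring.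
set m := Rl (ie e) u in dm mE pos1 pos2 mdiff.
set v := Rl (ie e) h in mdiff bv.
have Am : A m = u + ie e *: m by apply/eqP; rewrite -subr_eq mE.
have dAm : dom A (A m) by rewrite Am addrC; exact: domP.
have AAm : A (A m) = h - (e ^+ 2)%:C *: m.
  rewrite {1}Am addrC opP // Am scalerDr scalerA ie_sqr scaleNr.
  have -> : A u = h - ie e *: u.
    by apply/eqP; rewrite -subr_eq -scaleNr -ieN uE.
  by rewrite addrC addrA subrK.
have dAAm : dom A (A (A m)) by rewrite AAm; apply: domB => //; exact: domZ.
have hE : h = A (A m) + (e ^+ 2)%:C *: m by rewrite AAm subrK.
have split : complex.Re [< A h, h >] = complex.Re [< A (A (A m)), A (A m) >] +
    2 * e ^+ 2 * complex.Re [< A (A m), A m >] + e ^+ 2 * e ^+ 2 * complex.Re [< A m, m >].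
  rewrite {1 2}hE opD ?opZ //; last exact: domZ.
  rewrite !(kfDl, kfZl, kfDr, kfZr) conjc_real (op_sym selfadjA dAAm dm).
  rewrite (kfC K (A (A m)) (A m)); move: (e ^+ 2) => t.
  by case: [< A (A (A m)), _ >] [< A (A m), A m >] [< A m, m >] => ? ? [? ?] [? ?] /=; ring.
pose p := (e ^+ 2)%:C *: m.
have e20 : 0 < e ^+ 2 by rewrite exprn_gt0.
have ne2 : rnorm ((e ^+ 2)%:C) = e ^+ 2 by rewrite rnormC gtr0_norm.
have ppE : complex.Re [< A p, p >] = e ^+ 2 * e ^+ 2 * complex.Re [< A m, m >].
  rewrite /p opZ // kfZl kfZr conjc_real; move: (e ^+ 2) => t.
  by case: [< A m, m >] => ? ? /=; ring.
have {split} lower : complex.Re [< A p, p >] <= complex.Re [< A h, h >].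
  rewrite split ppE lerDr addr_ge0 // !mulr_ge0 // ltW //.
apply: le_trans lower.
have dp : dom A p by exact: domZ.
have Ap : A p = (e ^+ 2)%:C *: A m by rewrite /p opZ.
have dAp : dom A (A p) by rewrite Ap; exact: domZ.
have AAp : A (A p) = (e ^+ 2)%:C *: (h - p) by rewrite Ap opZ // AAm.
have {}bu : rnorm u * e ^+ 2 <= M0 * rnorm h by apply: bu; rewrite normrN gtr0_norm.
have {}bv : rnorm v * e ^+ 2 <= M0 * rnorm h by apply: bv; rewrite gtr0_norm.
have np : rnorm p * e <= M0 * rnorm h.
  have E : (2 * ie e) *: m = v - u by rewrite {1}mdiff opprB addrC subrK.
  have : 2 * e * rnorm m <= rnorm v + rnorm u.
    by apply: le_trans (rnormB _ _); rewrite -E rnormZ rnormM rnorm_ie gtr0_norm // rnorm2.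
  by move=> /(ler_wpM2l (ltW e20)); rewrite /p rnormZ ne2; lra.
have nAp : rnorm (A p) <= M0 * rnorm h.
  have E : 2 *: A m = u + v.
    have -> : v = u + (2 * ie e) *: m by rewrite {1}mdiff subrK.
    by rewrite Am scalerDr scalerA scaler_nat mulr2n addrA.
  have : 2 * rnorm (A m) <= rnorm u + rnorm v.
    by apply: le_trans (rnormD _ _); rewrite -E rnormZ rnorm2.
  by move=> /(ler_wpM2l (ltW e20)); rewrite Ap rnormZ ne2; lra.
have nh : 0 <= rnorm h by exact: rnorm_ge0.
have [small|large] := leP (rnorm (A (A p))) (d * rnorm p).
  apply: le_trans (sqr_small dp dAp small).
  by rewrite oppr_le0 !mulr_ge0 ?invr_ge0 ?addr_ge0 // ltW.
have nAAp : rnorm (A (A p)) <= e * ((1 + M0) * rnorm h).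
  rewrite AAp rnormZ ne2; apply: (@le_trans _ _ (e ^+ 2 * (rnorm h + rnorm p))).
    by rewrite ler_wpM2l ?(ltW e20) // rnormB.
  have : e * (e * rnorm h) <= e * rnorm h.
    by rewrite ler_wpM2l ?(ltW e0) // -[leRHS]mul1r ler_wpM2r // ltW.
  by have := ler_wpM2l (ltW e0) np; lra.
have pd : rnorm p <= e * ((1 + M0) * rnorm h / d).
  rewrite mulrA ler_pdivlMr // mulrC; exact: le_trans (ltW large) nAAp.
have : - (rnorm (A p) * rnorm p) <= complex.Re [< A p, p >].
  have := le_trans (rnorm_Re _) (kform_CauchySchwarz K (A p) p).
  by rewrite ler_norml => /andP[].
apply: le_trans; rewrite lerN2 -mulrA [_ * e]mulrC.
by apply: ler_pM => //; exact: rnorm_ge0.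
Qed.

Let iterdom_le n n' f : (n' <= n)%N -> iterdom A n f -> iterdom A n' f.
Proof. by move=> nn df j jn; apply: df; exact: leq_trans nn. Qed.

Let iterdom_regular n e f : e != 0 -> iterdom A n f -> iterdom A n.+2 (regular e f).
Proof.
move=> e0 df; have rn : resolvent_set A (ie (- e)) by apply: ri; rewrite oppr_eq0.
by have [] := iterdom_resolvent (ri e0) (iterdom_resolvent rn df).1.
Qed.

(** The powers of [A] come off one at a time. For h = A k one has m = A (regular k), so A m and A^2
    m both lie in the range of A^2, where positivity is known; for h = k the vector A m would not be
    covered yet. *)
Lemma iter1_nonneg k : iterdom A 6 k -> 0 <= complex.Re [< A (A k), A k >].
Proof.
move=> k6; have Ak5 : iterdom A 5 (A k) by move=> j j5; rewrite -iterSr; exact: k6.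
apply: nonneg_of_regularized => [|e e0]; first exact: (k6 1%N).
have en0 : e != 0 by rewrite gt_eqF.
have rn : resolvent_set A (ie (- e)) by apply: ri; rewrite oppr_eq0.
have -> : regular e (A k) = A (regular e k).
  have dk : dom A k := k6 0%N isT.
  rewrite /regular -(resolvent_op_comm rn dk) -resolvent_op_comm //; first exact: ri.
  by have [] := resolventP k rn.
split; last by apply: iter2_nonneg; apply: iterdom_le (iterdom_regular en0 k6).
have := iterdom_regular en0 k6 => k8.
by apply: (iter2_nonneg (k := A (regular e k))) => j j6; rewrite -iterSr; apply: k8; exact: ltnW.
Qed.

Lemma iter0_nonneg k : iterdom A 6 k -> 0 <= complex.Re [< A k, k >].
Proof.
move=> k6; apply: nonneg_of_regularized => [|e e0]; first exact: (k6 0%N).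
have en0 : e != 0 by rewrite gt_eqF.
have m6 : iterdom A 6 (regular e k) by apply: iterdom_le (iterdom_regular en0 k6).
by split; [exact: iter2_nonneg|exact: iter1_nonneg].
Qed.

(** Induction: approximate g by g1 in the domain, then (A - i) g1 by a vector of the domain of A^n,
    and apply the bounded R(i). *)
Lemma iterdom_dense n g (e : R) : 0 < e ->
  exists2 g', iterdom A n g' & rnorm (g - g') < e.
Proof.
elim: n g e => [|n IH] g e e0; first by exists g => //; rewrite subrr rnorm0.
have [dA _] := selfadjA; have e20 : 0 < e / 2 by rewrite divr_gt0.
have [g1 [g1b dg1]] : (ball g (e / 2)%:C `&` dom A) !=set0.
  apply: dA; last by apply: ball_open; rewrite ltcR.
  by exists g; apply: ballxx; rewrite ltcR.
rewrite -ball_normE /= rnormE ltcR in g1b.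
have r1' : resolvent_set A (ie 1) by apply: ri; exact: oner_neq0.
have [c c0 cb] := resolvent_bounded r1'.
have [w dw wl] := IH (A g1 - ie 1 *: g1) (e / 2 / c) ltac:(by rewrite divr_gt0).
exists (Rl (ie 1) w); first by have [] := iterdom_resolvent r1' dw.
rewrite -(subrK g1 g) -addrA [ltRHS]splitr; apply: (le_lt_trans (rnormD _ _)); apply: ltrD => //.
rewrite -{1}(resolvent_op r1' dg1) -resolventB //.
by apply: (le_lt_trans (cb _)); rewrite mulrC -ltr_pdivlMr.
Qed.

(** Density must hold in the graph norm: approximating (A - i) h and applying R(i) makes both h' and
    A h' converge. *)
Lemma form_nonneg h : dom A h -> 0 <= complex.Re [< A h, h >].
Proof.
move=> dh; have r1' : resolvent_set A (ie 1) by apply: ri; exact: oner_neq0.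
have [c c0 cb] := resolvent_bounded r1'.
pose D := (1 + c) * rnorm h + (rnorm (A h) + (1 + c)) * c.
apply: (@ge0_of_linear_lower_bound _ _ D 1) => // e e0 e1.
have [w dw wl] := iterdom_dense 5 (A h - ie 1 *: h) e0.
set g := A h - _ in wl; pose h' := Rl (ie 1) w.
have h6 : iterdom A 6 h' by have [] := iterdom_resolvent r1' dw.
have dh' : dom A h' := h6 0%N isT.
have [_ hE'] := resolventP w r1'; rewrite -/h' in hE'.
have hh : rnorm (h - h') <= c * e.
  rewrite -{1}(resolvent_op r1' dh) -/g -resolventB //.
  by apply: (le_trans (cb _)); rewrite ler_wpM2l ?(ltW c0) // ltW.
have AE : A h - A h' = (g - w) + ie 1 *: (h - h').
  rewrite -[w]hE' /g scalerBr; move: (A h) (A h') (ie 1 *: h) (ie 1 *: h') => x y x' y'.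
  by rewrite opprB (addrC y' (- y)) (addrACA x) -(addrA (x - y)) (addrACA (- x')) addNr subrr !addr0.
have AA : rnorm (A h - A h') <= (1 + c) * e.
  rewrite AE mulrDl mul1r; apply: (le_trans (rnormD _ _)); apply: lerD; first exact: ltW.
  by rewrite rnormZ rnorm_ie normr1 mul1r.
have E : [< A h, h >] = [< A h', h' >] + ([< A h - A h', h >] + [< A h', h - h' >]).
  by rewrite kfBl kfBr; ring.
have pos := iter0_nonneg h6.
have nA : rnorm (A h') <= rnorm (A h) + (1 + c).
  have -> : A h' = A h - (A h - A h') by rewrite opprB addrC subrK.
  apply: (le_trans (rnormB _ _)); rewrite lerD2l (le_trans AA) //.
  by rewrite -[leRHS]mulr1 ler_wpM2l ?addr_ge0 // ltW.
have : rnorm ([< A h - A h', h >] + [< A h', h - h' >]) <= D * e.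
  apply: (le_trans (rnormD _ _)); rewrite mulrDl; apply: lerD.
    by apply: (le_trans (kform_CauchySchwarz _ _ _)); rewrite mulrAC ler_wpM2r ?rnorm_ge0.
  apply: (le_trans (kform_CauchySchwarz _ _ _)); rewrite -mulrA.
  by apply: ler_pM => //; exact: rnorm_ge0.
move=> /(le_trans (rnorm_Re _)); rewrite ler_norml => /andP[le1 _].
rewrite E; move: le1 pos; case: [< A h', h' >] (_ + _) => ? ? [? ?] /=; lra.
Qed.

End Backward.

(** * Growth conditions as pointwise bounds *)

Section GrowthBounds.
Variables (R : realType) (H : completeNormedModType R[i]) (A : operator H).

Lemma resolvent_opnorm_bound (l : R[i]) (M : R) g : complex.Im l != 0 -> resolvent_set A l ->
  (opnorm (resolvent A l) <= (M / `|complex.Im l| ^+ 2)%:E)%E ->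
  rnorm (resolvent A l g) * complex.Im l ^+ 2 <= M * rnorm g.
Proof.
move=> il rl /(resolvent_bound g rl); rewrite real_normK ?num_real // => le.
by rewrite -ler_pdivlMr ?exprn_even_gt0 // mulrAC.
Qed.

Lemma growth_at0_bound : growth_at A 2 0 -> exists r M : R, [/\ 0 < r, 0 <= M &
  forall l : R[i], complex.Im l != 0 -> rnorm l < r ->
    forall g, rnorm (resolvent A l g) * complex.Im l ^+ 2 <= M * rnorm g].
Proof.
move=> [U [M [oU U0 M0 UM]]].
have : nbhs (0 : R[i]^o) U by apply: open_nbhs_nbhs.
move=> /nbhs_ballP[e /= e0 eU].
have eE : e = (complex.Re e)%:C by rewrite RRe_real // gtr0_real.
rewrite eE ltcR in e0; exists (complex.Re e), M; split => //; first exact: ltW.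
move=> l il lr g; have [|rl le] := UM l _ il.
  by apply: eU; rewrite -ball_normE /= sub0r normrN rnormE eE ltcR.
exact: resolvent_opnorm_bound.
Qed.

(** A neighbourhood of infinity contains the complement of a compact set, which is bounded. *)
Lemma growth_at_infty_bound : growth_at_infty A 2 -> exists r M : R, [/\ 0 < r, 0 <= M &
  forall l : R[i], complex.Im l != 0 -> r < rnorm l ->
    forall g, rnorm (resolvent A l g) * complex.Im l ^+ 2 <= M * rnorm l ^+ 2 * rnorm g].
Proof.
move=> [U [M [oU U0 M0 UM]]].
have : nbhs (None : one_point_compactification (R[i]^o : topologicalType)) U.
  exact: open_nbhs_nbhs.
move=> [W [cW _] WU].
have /ex_strict_bound_gt0[r r0 /= Wr] : bounded_set ((@rnorm R R[i] : R[i]^o -> R) @` W).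
  apply: compact_bounded; apply: continuous_compact => //.
  by apply: continuous_subspaceT; exact: rnorm_continuous.
exists r, M; split => //; first exact: ltW.
move=> l il rl g; have [|sl le] := UM l _ il.
  apply: WU; left; exists l => //= Wl.
  have := Wr (rnorm l) (ex_intro2 _ _ l Wl erefl).
  by rewrite ger0_norm ?rnorm_ge0 // ltNge (ltW rl).
exact: resolvent_opnorm_bound.
Qed.

End GrowthBounds.

Lemma real_spectrum_nonreal (R : realType) (H : completeNormedModType R[i]) (A : operator H) :
  spectrum A `<=` [set x%:C | x in [set: R]] ->
  forall l : R[i], complex.Im l != 0 -> resolvent_set A l.
Proof.
move=> sR l; apply: contraPP => nr; have [x _ <-] := sR l nr.
by rewrite /= eqxx.
Qed.

Theorem theorem3p1 (R : realType) (H : completeNormedModType R[i])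
    (K : kreinSpace H) (A : operator H) (selfadjA : selfadjoint K A) :
  nonnegative K A <->
  [/\ (* (i) *)
      [/\ spectrum A `<=` [set x%:C | x in [set: R]],
          spectrum A `&` [set x%:C | x in [set x : R | 0 < x]]
            `<=` sigma_plus K A &
          spectrum A `&` [set x%:C | x in [set x : R | x < 0]]
            `<=` sigma_minus K A],
      (* (ii) *)
      growth_at_infty A 2 &
      (* (iii) *)
      growth_at A 2 0 /\
      forall f : nat -> H,
        (forall n, f n != 0) ->
        (forall n, dom A (f n) /\ dom A (A (f n))) ->
        `|f n|^-1 *: A (A (f n)) @[n --> \oo] --> (0 : H) ->
        (0 <= limn_einf (fun n => (complex.Re (kform K (A (f n)) (f n)))%:E))%E].
Proof.
split=> [[_ [l0 rl0] posA]|[[sR splus sminus] ginf [g0 seqA]]].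
  split; first split.
  - move=> l sl; have [il|il] := eqVneq (complex.Im l) 0.
      by exists (complex.Re l) => //; rewrite [RHS]complexE il mulr0 addr0.
    have [C _ CP] := nonreal_resolvent_bound selfadjA posA rl0.
    by have [rl _ _] := CP l il.
  - by move=> l [sx [x /= x0 xE]]; rewrite -xE in sx *; exact: (nonneg_sigma_plus selfadjA posA rl0).
  - by move=> l [sx [x /= x0 xE]]; rewrite -xE in sx *; exact: (nonneg_sigma_minus selfadjA posA rl0).
  - exact: (nonneg_growth_at_infty selfadjA posA rl0).
  - split; first exact: (nonneg_growth_at0 selfadjA posA rl0).
    move=> f _ df _; apply: limn_einf_ge; apply: nearW => n.
    by apply: (Aform_ge0 posA); have [] := df n.
have nonreal := real_spectrum_nonreal sR.
have [r0 [M0 [r00 M00 growth0]]] := growth_at0_bound g0.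
have [r1 [M1 [r10 M10 growth1]]] := growth_at_infty_bound ginf.
have [d d0 small] := op_sqr_small_nonneg seqA.
have axis (x : R) : x != 0 -> exists d C, [/\ 0 < d, 0 <= C &
    forall l, rnorm (l - x%:C) < d -> forall f, dom A f ->
    - (C * rnorm (A f - l *: f) ^+ 2) <= complex.Re (kform K (A f) f)].
  move=> x0.
  (* Weighting [f, f] by [x] merges positive type on the right with negative type on the left. *)
  have [|e e0 eP] := @definite_type_bound _ _ K A x.
    move=> sx f af; have [xpos|xneg] : 0 < x \/ x < 0.
        by move: x0; rewrite neq_lt => /orP[]; [right|left].
      have [_ /(_ f af) /limn_einf_gt0[c c0 cf]] : sigma_plus K A x%:C.
        by apply: splus; split=> //; exists x.
      exists (x * c); first exact: mulr_gt0.
      by apply: filterS cf => n cn; rewrite ler_wpM2l // ltW.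
    have [_ /(_ f af)] : sigma_minus K A x%:C by apply: sminus; split=> //; exists x.
    rewrite -oppe_gt0 -limn_einfN => /(@limn_einf_gt0 _ (fun n => - _))[c c0 cf].
    exists (- x * c); first by rewrite mulr_gt0 // oppr_gt0.
    apply: filterS cf => n cn; rewrite -[leRHS]mulrNN ler_wpM2l // oppr_ge0 ltW //.
  exact: definite_type_lower_bound x0 e0 eP.
split=> //.
  by exists 'i%C; apply: nonreal; rewrite /= oner_eq0.
move=> f df; rewrite lecE /= (op_form_real selfadjA df) eqxx /=.
exact: (form_nonneg selfadjA nonreal r00 r10 M00 M10 growth0 growth1 axis d0 small df).
Qed.
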